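(* Let $E$ be a Fréchet space. The following assertions are equivalent: (i) $E$ is not Montel; (ii) $E$ has the Josefson--Nissenzweig property (JNP); (iii) $E_w$ has the JNP.
   Context: All locally convex spaces (lcs) are over the field $\mathbb{F}$ of real or complex numbers, Hausdorff and infinite-dimensional. $E'$ is the topological dual of $E$. A barrel in an lcs $E$ is a closed absorbent absolutely convex subset. A set $B\subseteq E$ is barrel-bounded if for every barrel $U\subseteq E$ there is $n\in\mathbb{N}$ with $B\subseteq nU$. The topology $\beta^*(E',E)$ on $E'$ is the locally convex topology of uniform convergence on barrel-bounded subsets of $E$: a neighborhood base at zero is given by the polars $B^\circ=\{\chi\in E': |\chi(x)|\le 1 \text{ for all } x\in B\}$ of barrel-bounded sets $B\subseteq E$. $E'_{w^*}$ is $E'$ with the weak$^*$ topology $\sigma(E',E)$ and $E'_{\beta^*}$ is $E'$ with $\beta^*(E',E)$. The space $E$ has the Josefson--Nissenzweig property (JNP) if the identity map $E'_{w^*}\to E'_{\beta^*}$ is not sequentially continuous; equivalently, there is a sequence in $E'$ converging to $0$ in $\sigma(E',E)$ but not in $\beta^*(E',E)$. $E_w$ denotes $E$ endowed with its weak topology $\sigma(E,E')$. $E$ is reflexive if the canonical evaluation map $\psi_E:E\to E''=(E'_\beta)'_\beta$, $\psi_E(x)(\chi)=\chi(x)$, is a topological isomorphism, where $\beta$ denotes the strong dual topology (uniform convergence on bounded sets). $E$ is Montel if it is reflexive and every closed bounded subset of $E$ is compact. *)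

(* Defs.v *)
From HB Require Import structures.
From mathcomp Require Import all_boot all_order all_algebra complex.
From mathcomp Require Import all_classical all_reals all_analysis.

Set Implicit Arguments.
Unset Strict Implicit.
Unset Printing Implicit Defensive.

Import Order.TTheory GRing.Theory Num.Theory.
Import numFieldNormedType.Exports.

Local Open Scope classical_set_scope.
Local Open Scope ring_scope.

Variant real_or_complex (R : realType) : numFieldType -> Prop :=
| RC_real : real_or_complex R R
| RC_complex : real_or_complex R R[i].

Section vector_space_sets.
Context (K : numFieldType) (V : lmodType K).

Definition absolutely_convex (U : set V) :=
  forall (a b : K) (x y : V),
    U x -> U y -> `|a| + `|b| <= 1 -> U (a *: x + b *: y).

Definition absorbs (U B : set V) :=
  exists2 r : K, 0 < r &
    forall t : K, r <= `|t| -> B `<=` [set t *: u | u in U].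

Definition absorbent (U : set V) := forall x, absorbs U [set x].

Definition finite_dimensional :=
  exists n (e : 'I_n -> V), forall x, exists c : 'I_n -> K,
    x = \sum_(i < n) c i *: e i.

(* Base of zero neighborhoods of a locally convex topology. *)
Record zero_base (B : set_system V) : Prop := ZeroBase {
  zb_nonempty : exists U, B U;
  zb_directed : forall U W, B U -> B W ->
    exists2 X, B X & X `<=` U `&` W;
  zb_absconvex : forall U, B U -> absolutely_convex U;
  zb_absorbent : forall U, B U -> absorbent U;
  zb_scale : forall (c : K) U, B U ->
    exists2 W, B W & forall w, W w -> U (c *: w) }.

End vector_space_sets.

Fact conv_translate (K : numFieldType) (V : lmodType K) (l : K) (x y1 y2 z : V) :
  l *: (y1 + (z - (l *: y1 + (1 - l) *: y2)) - x) +
  (1 - l) *: (y2 + (z - (l *: y1 + (1 - l) *: y2)) - x) = z - x.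
Proof.
have lD v : l *: v + (1 - l) *: v = v.
  by rewrite -scalerDl addrCA subrr addr0 scale1r.
set y := l *: y1 + _; set d := z - y.
rewrite -!(addrA _ d) !scalerDr addrACA -!scalerDr lD -/y.
by rewrite addrA /d addrCA subrr addr0.
Qed.

(* The locally convex topology with base of neighborhoods [x + U], [U] in the
   given zero base. *)
HB.factory Record Lmodule_hasZeroBase (K : numFieldType) V
    & GRing.Lmodule K V := {
  zbase : set_system V;
  zbaseP : zero_base zbase
}.

HB.builders Context K V & Lmodule_hasZeroBase K V.

Definition znbhs (x : V) : set_system V :=
  filter_from zbase (fun U => [set y | U (y - x)]).

HB.instance Definition _ := hasNbhs.Build V znbhs.

Let zb0 U : zbase U -> U 0.
Proof.
move=> BU; have [r r0 rU] := zb_absorbent zbaseP BU 0.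
have [|u Uu _] := rU r _ 0 erefl; first by rewrite gtr0_norm.
have := zb_absconvex zbaseP BU (a := 0) (b := 0) Uu Uu.
by rewrite normr0 addr0 !scale0r addr0; exact.
Qed.

Let zb_half U : zbase U ->
  exists2 W, zbase W & forall x y, W x -> W y -> U (x + y).
Proof.
move=> BU; have [W BW WU] := zb_scale zbaseP 2 BU.
exists W => // x y /WU Ux /WU Uy.
have := zb_absconvex zbaseP BU (a := 2^-1) (b := 2^-1) Ux Uy.
rewrite !scalerA mulVf// !scale1r; apply.
by rewrite gtr0_norm// -[X in X + _]mul1r -[X in _ + X]mul1r -splitr.
Qed.

Let zpfilter (x : V) : ProperFilter (znbhs x).
Proof.
apply: Build_ProperFilter_ex => [A [U BU UA]|].
  by exists x; apply: UA => /=; rewrite subrr; exact: zb0.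
apply: filter_from_filter; first exact: (zb_nonempty zbaseP).
move=> U W BU BW; have [X BX XUW] := zb_directed zbaseP BU BW.
by exists X => // y /= /XUW.
Qed.

Let zsingleton (x : V) A : nbhs x A -> A x.
Proof. by case=> U BU; apply => /=; rewrite subrr; exact: zb0. Qed.

Let znbhs_nbhs (x : V) A : nbhs x A -> nbhs x (nbhs^~ A).
Proof.
case=> U BU UA; have [W BW WU] := zb_half BU.
exists W => // y /= Wy; exists W => // z /= Wz; apply: UA => /=.
by rewrite -(subrK y z) -addrA; exact: WU.
Qed.

HB.instance Definition _ :=
  Nbhs_isNbhsTopological.Build V zpfilter zsingleton znbhs_nbhs.

Let zadd_continuous : continuous (fun x : V * V => x.1 + x.2).
Proof.
move=> [x y] A /= [U BU UA]; have [W BW WU] := zb_half BU.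
exists ([set u | W (u - x)], [set v | W (v - y)]); first by split; exists W.
move=> [u v] /= [Wu Wv]; apply: UA => /=.
by rewrite opprD addrACA; exact: WU.
Qed.

Let zscale_continuous : continuous (fun z : K^o * V => z.1 *: z.2).
Proof.
move=> [r x] A /= [U BU UA].
pose c : K := `|r| + 1; have c0 : 0 < c by rewrite ltr_wpDl.
have [W BW WU] := zb_scale zbaseP (2 * c) BU.
have [s s0 sU] := zb_absorbent zbaseP BU x.
have [|u Uu sux] := sU s _ x erefl; first by rewrite gtr0_norm.
have s20 : 0 < (2 * s)^-1 by rewrite invr_gt0 mulr_gt0.
exists ([set a : K^o | `|a - r| < 1 /\ `|a - r| < (2 * s)^-1],
        [set y | W (y - x)]).
  split; last by exists W.
  apply: filterI.
    rewrite /prop_near1/=; have := @nbhsx_ballx _ K^o r 1 ltr01.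
    by apply: filterS => a; rewrite -ball_normE /= distrC.
  have := @nbhsx_ballx _ K^o r _ s20.
  by apply: filterS => a; rewrite -ball_normE /= distrC.
move=> [a y] /= [[ar1 ars] Wy]; apply: UA => /=.
have -> : a *: y - r *: x =
    (a / (2 * c)) *: ((2 * c) *: (y - x)) + ((a - r) * s) *: u.
  rewrite scalerA divfK ?gt_eqF ?mulr_gt0// -scalerA sux.
  by rewrite scalerBr scalerBl addrA subrK.
apply: (zb_absconvex zbaseP BU) => //; first exact: WU.
have h1 : `|a / (2 * c)| <= 2^-1.
  rewrite normrM normfV (@gtr0_norm _ (2 * c)) ?mulr_gt0//.
  rewrite invfM mulrCA ler_piMr// ler_pdivrMr// mul1r /c.
  rewrite -(subrK r a) (le_trans (ler_normD _ _))// addrC lerD2l.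
  exact: ltW.
have h2 : `|(a - r) * s| <= 2^-1.
  rewrite normrM (gtr0_norm s0) -ler_pdivlMr// -invfM.
  exact: ltW.
by rewrite (le_trans (lerD h1 h2))// -[X in X + _]mul1r -[X in _ + X]mul1r
  -splitr.
Qed.

Let zconvex : exists2 B : set_system V,
  (forall b, b \in B -> convex_set b) & basis B.
Proof.
exists [set b | open b /\ convex_set b].
  by move=> b; rewrite inE => -[].
split; first by move=> b [].
move=> x A [U BU UA].
pose C := [set y | U (y - x)]; have nC : nbhs x C by exists U.
exists (interior C); last by move=> y /interior_subset/UA.
split; last exact: nC.
split; first exact: open_interior.
move=> y1 y2 l; rewrite !inE => -[W1 BW1 WC1] [W2 BW2 WC2].
have [W BW WW] := zb_directed zbaseP BW1 BW2.
have l0 : 0 <= l%:num by [].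
have l1 : 0 <= 1 - l%:num by rewrite subr_ge0.
exists W => // z /= /WW[W1z W2z].
set y := (X in z - X) in W1z W2z.
have /WC1 /= C1 : [set v | W1 (v - y1)] (y1 + (z - y)).
  by rewrite /= addrAC subrr add0r.
have /WC2 /= C2 : [set v | W2 (v - y2)] (y2 + (z - y)).
  by rewrite /= addrAC subrr add0r.
have := zb_absconvex zbaseP BU (a := l%:num) (b := 1 - l%:num) C1 C2.
rewrite !ger0_norm// addrCA subrr addr0 => /(_ (lexx _)).
by rewrite /C /= conv_translate.
Qed.

HB.instance Definition _ :=
  PreTopologicalLmod_isTvs.Build K V zadd_continuous zscale_continuous zconvex.
HB.instance Definition _ :=
  PreTopologicalNmodule_isTopologicalNmodule.Build V zadd_continuous.
HB.instance Definition _ :=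
  TopologicalNmodule_isTopologicalLmodule.Build K V zscale_continuous.
HB.instance Definition _ := Uniform_isTvs.Build K V zconvex.
HB.end.

Section topological_sets.
Context (K : numFieldType) (E : tvsType K).

Definition barrel (U : set E) :=
  [/\ closed U, absorbent U & absolutely_convex U].

Definition barrel_bounded (B : set E) :=
  forall U, barrel U -> exists n : nat, B `<=` [set n%:R *: u | u in U].

(* von Neumann boundedness *)
Definition tvs_bounded (B : set E) :=
  forall U, nbhs (0 : E) U -> absorbs U B.

(* Completeness for the translation-invariant uniformity: [tvsType] does not
   force the entourages of [E] to be those determined by zero neighborhoods,
   so the library's [cauchy] cannot be used here. *)
Definition tvs_cauchy (F : set_system E) :=
  forall U, nbhs (0 : E) U ->
    exists2 A, F A & forall x y, A x -> A y -> U (x - y).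

Definition tvs_complete :=
  forall F : set_system E, ProperFilter F -> tvs_cauchy F ->
    exists x : E, F --> x.

Definition is_dual : set (E -> K^o) := [set f | linear f /\ continuous f].

Lemma is_dual_submod : submod_closed (mem is_dual).
Proof.
split; first by rewrite inE; split=> [a x y|]; [rewrite scaler0 addr0|exact: cst_continuous].
move=> a f g; rewrite !inE => -[fl fc] [gl gc]; split=> [b x y|x].
  rewrite !fctE fl gl !scalerDr !scalerA (mulrC b) -!addrA; congr (_ + _).
  by rewrite addrCA.
by apply: cvgD; [apply: cvgZr; exact: fc|exact: gc].
Qed.

End topological_sets.

Section dual.
Context (K : numFieldType) (E : tvsType K).

Definition dual_pred : {pred E -> K^o} := mem (is_dual (E := E)).
HB.instance Definition _ :=
  GRing.isSubmodClosed.Build K (E -> K^o) dual_pred (is_dual_submod E).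

(* The topological dual E', as a vector space. *)
Record tdual := TDual { dual_fun :> E -> K^o; dual_funP : dual_fun \in dual_pred }.
HB.instance Definition _ := [isSub for dual_fun].
HB.instance Definition _ := [Choice of tdual by <:].
HB.instance Definition _ := [SubChoice_isSubLmodule of tdual by <:].
End dual.

Section dual_theory.
Context (K : numFieldType) (E : tvsType K).
Implicit Types (f g : tdual E) (x y : E) (c : K).

Lemma dualP f : linear (f : E -> K^o) /\ continuous (f : E -> K^o).
Proof. by have := dual_funP f; rewrite inE. Qed.

Lemma dual_linearP f c x y : f (c *: x + y) = c * f x + f y.
Proof. exact: (dualP f).1. Qed.

Lemma dual0 f : f 0 = 0.
Proof.
have := dual_linearP f 1 0 0; rewrite scale1r addr0 mul1r => h.
by apply: (addrI (f 0)); rewrite addr0.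
Qed.

Lemma dualZ f c x : f (c *: x) = c * f x.
Proof. by rewrite -[c *: x]addr0 dual_linearP dual0 addr0. Qed.

Lemma dualD f x y : f (x + y) = f x + f y.
Proof. by rewrite -[x]scale1r dual_linearP mul1r scale1r. Qed.

Lemma dual_continuous f : continuous (f : E -> K^o).
Proof. exact: (dualP f).2. Qed.

Lemma dualDE f g x : (f + g) x = f x + g x. Proof. by []. Qed.
Lemma dualZE f c x : (c *: f) x = c * f x. Proof. by []. Qed.

Lemma dual_ball_closed f : closed [set x | `|f x| <= 1].
Proof.
apply: (@preimage_closed _ _ (f : E -> K^o) [set k : K^o | `|k| <= 1]).
  by move=> x _; exact: dual_continuous.
move=> k kcl; apply/ler_addgt0Pr => e e0.
have /kcl[l [/= l1]] := @nbhsx_ballx _ K^o k e e0.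
rewrite -ball_normE /= => kl.
rewrite -(subrK l k) (le_trans (ler_normD _ _))// addrC lerD//; exact: ltW.
Qed.

Lemma dual_ball_nbhs f : nbhs (0 : E) [set x | `|f x| <= 1].
Proof.
have fc := @dual_continuous f 0; rewrite /continuous_at dual0 in fc.
have h : \forall x \near (0 : E), ball (0 : K^o) 1 (f x).
  by apply: fc; exact: nbhsx_ballx.
apply: filterS h => x.
by rewrite -ball_normE /= sub0r normrN => /ltW.
Qed.

End dual_theory.

Section polar_base.
Context (K : numFieldType) (V I : lmodType K) (p : V -> I -> K).
Hypothesis plinl : forall i c u v, p (c *: u + v) i = c * p u i + p v i.
Hypothesis plinr : forall c v i, p v (c *: i) = c * p v i.
Context (S : set_system I).
Hypothesis S0 : exists A, S A.
Hypothesis SU : forall A B, S A -> S B -> S (A `|` B).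
Hypothesis SZ : forall c A, S A -> S [set c *: i | i in A].
Hypothesis Sbnd : forall v A, S A ->
  exists2 r, 0 < r & forall i, A i -> `|p v i| <= r.

Let polar_of (A : set I) : set V := [set v | forall i, A i -> `|p v i| <= 1].

Lemma polar_zero_base : zero_base [set polar_of A | A in S].
Proof.
have p0 i : p 0 i = 0.
  have := plinl i 1 0 0; rewrite scale1r addr0 mul1r => h.
  by apply: (addrI (p 0 i)); rewrite addr0.
have pZ c v i : p (c *: v) i = c * p v i by rewrite -[c *: v]addr0 plinl p0 addr0.
split.
- by have [A SA] := S0; exists (polar_of A), A.
- move=> _ _ [A SA <-] [B SB <-]; exists (polar_of (A `|` B)).
    by exists (A `|` B) => //; exact: SU.
  by move=> v vAB; split=> i Ai; apply: vAB; [left|right].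
- move=> _ [A SA <-] a b u v Pu Pv ab i Ai.
  rewrite plinl pZ (le_trans (ler_normD _ _))// !normrM (le_trans _ ab)//.
  by rewrite lerD// ler_piMr// ?Pu ?Pv.
- move=> _ [A SA <-] v; have [r r0 rA] := Sbnd v SA.
  exists r => // t rt _ ->.
  have t0 : 0 < `|t| by exact: lt_le_trans rt.
  exists (t^-1 *: v); last by rewrite scalerA divff ?scale1r// -normr_gt0.
  move=> i Ai; rewrite pZ normrM normfV mulrC ler_pdivrMr// mul1r.
  by rewrite (le_trans _ rt)// rA.
- move=> c _ [A SA <-]; exists (polar_of [set c *: i | i in A]).
    by exists [set c *: i | i in A] => //; exact: SZ.
  by move=> v Pv i Ai; rewrite pZ -plinr; apply: Pv; exists i.
Qed.

End polar_base.

Section polars.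
Context (K : numFieldType) (E : tvsType K).

Definition polar (B : set E) : set (tdual E) :=
  [set f | forall x, B x -> `|f x| <= 1].

Definition prepolar (F : set (tdual E)) : set E :=
  [set x | forall f, F f -> `|f x| <= 1].

Lemma finite_set_bounded (T : Type) (A : set T) (q : T -> K) :
  finite_set A -> exists2 r, 0 < r & forall i, A i -> `|q i| <= r.
Proof.
elim/Pchoice: T => T in A q *.
move=> /finite_seqP[s ->]; exists (1 + \sum_(i <- s) `|q i|).
  by rewrite ltr_pwDl// sumr_ge0.
move=> i /= si; rewrite (big_rem _ si)/= addrCA lerDl addr_ge0//.
exact: sumr_ge0.
Qed.

Lemma weak_zero_base : zero_base [set prepolar F | F in finite_set].
Proof.
apply: (@polar_zero_base _ E (tdual E) (fun x f => f x)).
- by move=> f c x y; exact: dual_linearP.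
- by [].
- by exists set0.
- by move=> A B ? ?; rewrite finite_setU.
- by move=> c A ?; exact: finite_image.
- by move=> x A fA; have := finite_set_bounded (fun f : tdual E => f x : K) fA.
Qed.

Lemma weakstar_zero_base : zero_base [set polar B | B in finite_set].
Proof.
apply: (@polar_zero_base _ (tdual E) E (fun f x => f x)).
- by [].
- by move=> c f x; exact: dualZ.
- by exists set0.
- by move=> A B ? ?; rewrite finite_setU.
- by move=> c A ?; exact: finite_image.
- by move=> f A fA; have := finite_set_bounded (fun x : E => f x : K) fA.
Qed.

Lemma strong_zero_base : zero_base [set polar B | B in @tvs_bounded K E].
Proof.
apply: (@polar_zero_base _ (tdual E) E (fun f x => f x)).
- by [].
- by move=> c f x; exact: dualZ.
- by exists set0 => U _; exists 1 => // t _; exact: sub0set.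
- move=> A B bA bB U U0; have [r r0 rA] := bA U U0; have [s s0 sB] := bB U U0.
  exists (r + s); first exact: addr_gt0.
  move=> t rst x [Ax|Bx]; [apply: rA Ax|apply: sB Bx]; apply: le_trans rst.
    by rewrite lerDl ltW.
  by rewrite lerDr ltW.
- move=> c A bA U U0.
  have /bA[r r0 rA] : nbhs (0 : E) [set x | U (c *: x)].
    have /= := @scale_continuous _ E (c, 0) U.
    rewrite scaler0 => /(_ U0)[[P Q] [/= Pc Q0] PQ].
    by apply: filterS Q0 => x Qx; apply: (PQ (c, x)); split=> //=; exact: nbhs_singleton Pc.
  exists r => // t rt _ [x Ax <-].
  have [u /= Uu <-] := rA t rt x Ax.
  by exists (c *: u) => //; rewrite !scalerA mulrC.
- move=> f A bA; have [r r0 rA] := bA _ (dual_ball_nbhs f).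
  exists r => // x Ax; have [|u /= fu <-] := rA r _ x Ax; first by rewrite gtr0_norm.
  by rewrite dualZ normrM gtr0_norm// ler_piMr// ltW.
Qed.

Lemma barrel_absorbs_le (U : set E) (m n : nat) : barrel U -> (m <= n)%N ->
  [set m%:R *: u | u in U] `<=` [set n%:R *: u | u in U].
Proof.
move=> [_ aU cU] mn _ [u Uu <-].
have [n0|n0] := eqVneq n 0%N.
  by exists u => //; move: mn; rewrite n0 leqn0 => /eqP ->.
have nn0 : n%:R != 0 :> K by rewrite pnatr_eq0.
exists ((m%:R / n%:R) *: u); last by rewrite scalerA mulrC divfK.
rewrite -[_ *: u]addr0 -(scale0r u); apply: cU => //.
rewrite normr0 addr0 ger0_norm ?divr_ge0//.
by rewrite ler_pdivrMr ?mul1r ?ler_nat// ltr0n lt0n.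
Qed.

Lemma barrel_dual_ball (f : tdual E) : barrel [set x | `|f x| <= 1].
Proof.
split; first exact: dual_ball_closed.
- move=> x; exists (`|f x| + 1); first by rewrite ltr_wpDl.
  move=> t xt _ ->.
  have t0 : 0 < `|t| by apply: lt_le_trans xt; rewrite ltr_wpDl.
  exists (t^-1 *: x); last by rewrite scalerA divff ?scale1r// -normr_gt0.
  rewrite /= dualZ normrM normfV mulrC ler_pdivrMr// mul1r.
  by rewrite (le_trans _ xt)// lerDl.
- move=> a b x y /= fx fy ab; rewrite dualD !dualZ (le_trans (ler_normD _ _))//.
  by rewrite !normrM (le_trans _ ab)// lerD// ler_piMr.
Qed.

Lemma betastar_zero_base : zero_base [set polar B | B in @barrel_bounded K E].
Proof.
apply: (@polar_zero_base _ (tdual E) E (fun f x => f x)).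
- by [].
- by move=> c f x; exact: dualZ.
- by exists set0 => U _; exists 0%N; exact: sub0set.
- move=> A B bA bB U bU; have [m mA] := bA U bU; have [n nB] := bB U bU.
  exists (maxn m n) => x [/mA|/nB]; apply: barrel_absorbs_le => //.
    exact: leq_maxl.
  exact: leq_maxr.
- move=> c A bA U bU.
  have /bA[n nA] : barrel [set x | U (c *: x)].
    case: bU => clU aU cU; split.
    + apply: (@preimage_closed _ _ (fun x : E => c *: x)) => // x _ W.
      move=> /(@scale_continuous _ E (c, x))[[P Q] [/= Pc Qx] PQ].
      apply: filterS Qx => y Qy; apply: (PQ (c, y)); split=> //=.
      exact: nbhs_singleton Pc.
    + move=> x; have [r r0 rU] := aU (c *: x); exists r => // t rt _ ->.
      have t0 : t != 0 by rewrite -normr_gt0; exact: lt_le_trans rt.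
      have [u Uu tu] := rU t rt _ erefl.
      exists (t^-1 *: x); last by rewrite scalerA divff// scale1r.
      by rewrite /= scalerA mulrC -scalerA -tu scalerA mulVf// scale1r.
    + move=> a b x y /= Ux Uy ab.
      rewrite scalerDr !scalerA ![c * _]mulrC -!scalerA; exact: cU.
  exists n => _ [x Ax <-]; have [u /= Uu <-] := nA x Ax.
  by exists (c *: u) => //; rewrite !scalerA mulrC.
- move=> f A bA; have [n nA] := bA _ (barrel_dual_ball f).
  exists (n%:R + 1); first by rewrite ltr_wpDl.
  move=> x /nA[u /= fu <-].
  by rewrite dualZ normrM ger0_norm// (le_trans (ler_piMr _ fu))// lerDl.
Qed.

(* E_w *)
Definition weak_space : Type := E.
HB.instance Definition _ := GRing.Lmodule.copy weak_space E.
HB.instance Definition _ :=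
  Lmodule_hasZeroBase.Build K weak_space weak_zero_base.

(* E'_{w^*} *)
Definition weakstar_dual : Type := tdual E.
HB.instance Definition _ := GRing.Lmodule.copy weakstar_dual (tdual E).
HB.instance Definition _ :=
  Lmodule_hasZeroBase.Build K weakstar_dual weakstar_zero_base.

(* E'_{beta^*} *)
Definition betastar_dual : Type := tdual E.
HB.instance Definition _ := GRing.Lmodule.copy betastar_dual (tdual E).
HB.instance Definition _ :=
  Lmodule_hasZeroBase.Build K betastar_dual betastar_zero_base.

(* E'_beta *)
Definition strong_dual : Type := tdual E.
HB.instance Definition _ := GRing.Lmodule.copy strong_dual (tdual E).
HB.instance Definition _ :=
  Lmodule_hasZeroBase.Build K strong_dual strong_zero_base.

End polars.

Section dual_topologies.
Context (K : numFieldType) (E : tvsType K).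

Lemma nbhs_weak_space (x : weak_space E) (A : set E) :
  nbhs x A <-> exists2 F, finite_set F & forall y : E, prepolar F (y - x) -> A y.
Proof.
split=> [[_ [F fF <-]] FA|[F fF FA]]; first by exists F.
by exists (prepolar F) => //; exists F.
Qed.

Lemma nbhs_weakstar_dual (f : weakstar_dual E) (A : set (tdual E)) :
  nbhs f A <->
  exists2 B, finite_set B & forall g : tdual E, polar B (g - f) -> A g.
Proof.
split=> [[_ [B fB <-]] BA|[B fB BA]]; first by exists B.
by exists (polar B) => //; exists B.
Qed.

Lemma nbhs_betastar_dual (f : betastar_dual E) (A : set (tdual E)) :
  nbhs f A <->
  exists2 B, barrel_bounded B & forall g : tdual E, polar B (g - f) -> A g.
Proof.
split=> [[_ [B bB <-]] BA|[B bB BA]]; first by exists B.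
by exists (polar B) => //; exists B.
Qed.

Lemma nbhs_strong_dual (f : strong_dual E) (A : set (tdual E)) :
  nbhs f A <->
  exists2 B, tvs_bounded B & forall g : tdual E, polar B (g - f) -> A g.
Proof.
split=> [[_ [B bB <-]] BA|[B bB BA]]; first by exists B.
by exists (polar B) => //; exists B.
Qed.

Lemma tvs_bounded1 (x : E) : tvs_bounded [set x].
Proof.
move=> U U0; have := @scale_continuous _ E (0, x) U.
rewrite /= scale0r => /(_ U0)[[P Q] [/= P0 Qx] PQ].
have [e e0 eP] : exists2 e : K, 0 < e & forall k : K, `|k| < e -> P k.
  move: P0 => /nbhs_ballP[e /= e0 eP]; exists e => // k ke.
  by apply: eP; rewrite -ball_normE /= sub0r normrN.
exists (2 / e); first by rewrite divr_gt0.
move=> t et _ ->; have t0 : 0 < `|t| by apply: lt_le_trans et; rewrite divr_gt0.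
exists (t^-1 *: x); last by rewrite scalerA divff ?scale1r// -normr_gt0.
apply: (PQ (t^-1, x)); split=> /=; last exact: nbhs_singleton Qx.
apply: eP; rewrite normfV invf_plt ?posrE//.
by apply: lt_le_trans et; rewrite -[X in X < _]mul1r ltr_pM2r ?invr_gt0// ltr1n.
Qed.

Lemma eval_is_dual (x : E) :
  (fun f : strong_dual E => (f : tdual E) x) \in @dual_pred K (strong_dual E).
Proof.
rewrite inE; split=> [c f g//|f].
move=> A /nbhs_ballP[e /= e0 eA].
have b : tvs_bounded [set (2 / e) *: x] by exact: tvs_bounded1.
apply: (_ : nbhs f ((fun g : strong_dual E => (g : tdual E) x) @^-1` A)).
apply/(nbhs_strong_dual f); exists [set (2 / e) *: x] => // g.
move=> /(_ _ erefl); rewrite dualZ normrM gtr0_norm ?divr_gt0//.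
rewrite -ler_pdivlMl ?divr_gt0// mulr1 invf_div => gf.
apply: eA; rewrite -ball_normE /=.
by rewrite distrC (le_lt_trans gf)// ltr_pdivrMr// ltr_pMr// ltr1n.
Qed.

(* The canonical map psi_E : E -> E''. *)
Definition eval_bidual (x : E) : strong_dual (strong_dual E) :=
  TDual (eval_is_dual x).

End dual_topologies.

Definition seq_continuous (X Y : topologicalType) (f : X -> Y) :=
  forall (u : nat -> X) (x : X), u @ \oo --> x -> (f \o u) @ \oo --> f x.

Definition top_isomorphism (K : numFieldType) (E F : tvsType K) (f : E -> F) :=
  [/\ linear f, continuous f &
      exists g : F -> E, [/\ cancel f g, cancel g f & continuous g]].

Record is_metric (R : realType) (T : Type) (d : T -> T -> R) : Prop := IsMetric {
  metric_ge0 : forall x y, 0 <= d x y;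
  metric_eq0 : forall x y, d x y = 0 <-> x = y;
  metric_sym : forall x y, d x y = d y x;
  metric_triangle : forall x y z, d x z <= d x y + d y z }.

Definition metrizable (R : realType) (T : topologicalType) :=
  exists2 d : T -> T -> R, is_metric d &
    forall (x : T) (A : set T),
      nbhs x A <-> exists2 e, 0 < e & [set y | d x y < e] `<=` A.

Section spaces.
Context (K : numFieldType) (E : tvsType K).

Definition frechet (R : realType) := metrizable R E /\ tvs_complete E.

Definition reflexive_tvs := top_isomorphism (@eval_bidual K E).

Definition montel :=
  reflexive_tvs /\ forall B : set E, closed B -> tvs_bounded B -> compact B.

(* The Josefson--Nissenzweig property *)
Definition JNP :=
  ~ seq_continuous (id : weakstar_dual E -> betastar_dual E).

End spaces.

(* Main.v *)
From HB Require Import structures.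
Require Import Defs.
From mathcomp Require Import all_boot all_order all_algebra.
From mathcomp Require Import all_classical all_reals all_analysis.
From mathcomp Require Import complex ring lra.

(** For a Frechet space [E], the JNP fails iff every weak* null sequence of [E']
    converges to zero uniformly on bounded sets (barrels are neighborhoods of
    zero, so barrel-bounded sets are the bounded ones); [E] and [E_w] have the
    same dual and the same barrels, so (ii) and (iii) agree.  A weak* null
    sequence is equicontinuous by Banach-Steinhaus, hence uniformly null on
    relatively compact sets, so Montel spaces fail the JNP.

    Conversely, assume that weak* null sequences are uniformly null on bounded
    sets.  The heart of the matter is that every equicontinuous sequence then
    has a weak* convergent subsequence; this makes bounded sets precompact, and
    reflexivity follows from Hahn-Banach.

    First, every equicontinuous sequence has convergent averages of tails.
    Otherwise, a stabilization argument yields [delta > 0] and a bounded set of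
    points at which all such averages oscillate by [delta].  Repeatedly
    splitting a sequence at an oscillation point into two subsequences, whose
    half sum is kept and whose half difference is stored, produces functionals
    [F_m] and bounded points [y_m] with [F_m y_m >= delta / 2] and, by a
    Bessel inequality, [sum_m (F_m x)^2 <= p(x)^2]: a weak* null sequence
    which is not uniformly null.

    Second, by assumption the averages converge uniformly on bounded sets, so
    their limits are approximated by the countably many averages of the given
    sequence, even uniformly on a set [{p_0 <= r_0, ..., p_n <= r_n}].  Pass to
    a subsequence such that the approximable averages do not change under
    further extraction: then the cluster values at every point coincide. *)

Set Implicit Arguments.
Unset Strict Implicit.
Unset Printing Implicit Defensive.

Import Order.TTheory GRing.Theory Num.Theory.
Import numFieldNormedType.Exports.

Local Open Scope classical_set_scope.
Local Open Scope ring_scope.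

(** * Tails, averages and oscillation *)

(** Dependent choice in which each term answers to the whole list of its predecessors. *)
Lemma history_choice (T : Type) (P : seq T -> T -> Prop) :
  (forall l, exists t, P l t) -> exists f : nat -> T, forall n, P (mkseq f n) (f n).
Proof.
move=> /choice[next nextP].
pose l := fix l n := if n is n'.+1 then rcons (l n') (next (l n')) else [::].
have lE n : l n = mkseq (fun n => next (l n)) n.
  by elim: n => [//|n ih]; rewrite mkseqS -ih.
by exists (fun n => next (l n)) => n; rewrite -lE.
Qed.

Lemma invS_le (R : realType) (d : R) : 0 < d -> exists n : nat, n.+1%:R^-1 <= d.
Proof.
move=> d0; exists (Num.bound d^-1); rewrite -[leRHS]invrK lef_pV2 ?posrE ?invr_gt0//.
by rewrite (le_trans (ltW (archi_boundP _)))// ?ler_nat// invr_ge0 ltW.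
Qed.

(** * Refinements of sequences and stabilization *)

Section finer.
Context (X : Type) (cl : set X -> set X).
Hypothesis cl_sub : forall A, A `<=` cl A.
Hypothesis cl_min : forall A B, A `<=` cl B -> cl A `<=` cl B.
Implicit Types f g : nat -> X.

Definition tail f k : set X := [set f j | j in [set j | (k <= j)%N]].
(* [cl] is [id] for subsequences and [midhull] for averages; an index may repeat. *)
Definition finer g f := forall k, cl (tail f k) (g k).
Definition skip m f k := f (k + m)%N.

Lemma cl_tail f m n : (m <= n)%N -> cl (tail f n) `<=` cl (tail f m).
Proof.
move=> mn; apply: cl_min => _ [j /= nj <-]; apply: cl_sub; exists j => //=.
exact: leq_trans nj.
Qed.

Lemma finer_refl f : finer f f.
Proof. by move=> k; apply: cl_sub; exists k => /=. Qed.

Lemma finer_trans g f h : finer g f -> finer h g -> finer h f.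
Proof.
move=> gf hg k; apply: (cl_min _ (hg k)) => _ [j /= kj <-].
exact: (cl_tail kj (gf j)).
Qed.

Lemma finer_skip m f : finer (skip m f) f.
Proof. by move=> k; apply: cl_sub; exists (k + m)%N => //=; rewrite leq_addr. Qed.

Lemma skip_finer m g f : finer g f -> finer (skip m g) (skip m f).
Proof.
move=> gf k; apply: cl_min (gf (k + m)%N) => _ [j /= kmj <-].
apply: cl_sub; exists (j - m)%N.
  by rewrite /= leq_subRL ?(leq_trans _ kmj) ?leq_addl// addnC.
by rewrite /skip subnK// (leq_trans _ kmj)// leq_addl.
Qed.

(** Past index [n], the diagonal only meets sequences that refine [F n], at indices that are no
    smaller. *)
Lemma finer_diag (F : nat -> nat -> X) n :
  (forall n, finer (F n.+1) (F n)) -> finer (skip n (fun k => F k k)) (F n).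
Proof.
move=> FS.
have Fle m : finer (F (m + n)%N) (F n).
  by elim: m => [|m ih]; [exact: finer_refl|exact: finer_trans ih (FS _)].
by move=> k; exact: (cl_tail (leq_addr n k) (Fle k _)).
Qed.

(** Run through the countably many properties, passing at each stage to a refinement with [P i]
    whenever one exists, and take the diagonal. Heredity and insensitivity to initial terms carry
    every decision over to the diagonal, which refines a stage only up to finitely many terms. *)
Lemma finer_stabilize (I : countType) (P : I -> (nat -> X) -> Prop) f :
  (forall i f g, finer g f -> P i f -> P i g) ->
  (forall i m g, P i (skip m g) -> P i g) ->
  exists2 g, finer g f & forall i, P i g \/ (forall g', finer g' g -> ~ P i g').
Proof.
move=> Pf Ps.
have /choice[next nextP] (ig : nat * (nat -> X)) :
    exists g', finer g' ig.2 /\ forall i, unpickle ig.1 = Some i ->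
      P i g' \/ (forall g'', finer g'' ig.2 -> ~ P i g'').
  case: ig => n g /=; case: (unpickle n) => [i|]; last first.
    by exists g; split=> //; exact: finer_refl.
  have [[g' [gg' Pg']]|nP] := pselect (exists g', finer g' g /\ P i g').
    by exists g'; split=> // _ [<-]; left.
  exists g; split; first exact: finer_refl.
  by move=> _ [<-]; right=> g' gg' Pg'; apply: nP; exists g'.
pose F := fix F n := if n is n'.+1 then next (n', F n') else f.
have FS n : finer (F n.+1) (F n) by have [] := nextP (n, F n).
exists (fun k => F k k) => [|i].
  by have := finer_diag 0 FS; congr (finer _ _); apply/funext => k; rewrite /skip addn0.
have [_ /(_ i)] := nextP (pickle i, F (pickle i)).
rewrite pickleK => /(_ erefl)[Pi|nP]; [left|right].
  apply: (Ps _ (pickle i).+1); apply: Pf Pi.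
  exact: (finer_diag (pickle i).+1 FS).
move=> g' g'F Pg'; apply: (nP (skip (pickle i) g')).
  apply: finer_trans; last exact: skip_finer g'F.
  exact: finer_diag.
by apply: Pf Pg'; exact: finer_skip.
Qed.

End finer.

(** * Iterated midpoints and oscillation at a point *)

Section midpoint_hull.
Context (R : realType) (V : Type).
Implicit Types (f g h : nat -> V -> R) (A : set (V -> R)) (x : V).

Definition mid (u v : V -> R) : V -> R := fun x => (u x + v x) / 2.

(** Iterated midpoints replace general convex combinations: they suffice for the splitting argument,
    and a fixed sequence has only countably many of them. *)
Inductive midhull A : set (V -> R) :=
| midhull_base u of A u : midhull A u
| midhull_mid u v of midhull A u & midhull A v : midhull A (mid u v).

Lemma midhull_sub A : A `<=` midhull A.
Proof. exact: midhull_base. Qed.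

Lemma midhull_min A B : A `<=` midhull B -> midhull A `<=` midhull B.
Proof. by move=> AB u; elim=> [v /AB//|v w _ Bv _ Bw]; exact: midhull_mid. Qed.

Lemma midhull_le A u x a : midhull A u -> u x <= a -> exists2 v, A v & v x <= a.
Proof.
elim=> [v Av va|v w _ ihv _ ihw vwa]; first by exists v.
have [/ihv//|av] := leP (v x) a; apply: ihw.
by move: vwa; rewrite /mid ler_pdivrMr//; lra.
Qed.

Lemma midhull_ge A u x a : midhull A u -> a <= u x -> exists2 v, A v & a <= v x.
Proof.
elim=> [v Av va|v w _ ihv _ ihw vwa]; first by exists v.
have [/ihv//|av] := leP a (v x); apply: ihw.
by move: vwa; rewrite /mid ler_pdivlMr//; lra.
Qed.

Lemma midhull_stable A (L : set (V -> R)) :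
  (forall u v, L u -> L v -> L (mid u v)) -> A `<=` L -> midhull A `<=` L.
Proof. by move=> Lm AL u; elim=> [v /AL|v w _ Lv _ Lw]//; exact: Lm. Qed.

(* The averages of a sequence are indexed by a countable type. *)
Fixpoint midtree_eval f (t : GenTree.tree nat) : V -> R :=
  match t with
  | GenTree.Leaf n => f n
  | GenTree.Node _ (t1 :: t2 :: _) => mid (midtree_eval f t1) (midtree_eval f t2)
  | _ => f 0
  end.

Lemma midhull_midtree f u : midhull (range f) u -> exists t, u = midtree_eval f t.
Proof.
elim=> [v [n _ <-]|v w _ [t ->] _ [t' ->]]; first by exists (GenTree.Leaf n).
by exists (GenTree.Node 0 [:: t; t']).
Qed.

Definition finer_sub := @finer (V -> R) id.
Definition finer_mid := @finer (V -> R) midhull.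

Lemma finer_subP g f : finer_sub g f <-> forall k, exists2 j, (k <= j)%N & g k = f j.
Proof.
split=> [gf k|gf k]; first by have [j kj fg] := gf k; exists j.
by have [j kj ->] := gf k; exists j.
Qed.

Lemma finer_sub_mid g f : finer_sub g f -> finer_mid g f.
Proof. by move=> gf k; apply: midhull_sub; exact: gf. Qed.


Lemma finer_mid_stable g f (L : set (V -> R)) : finer_mid g f ->
  (forall u v, L u -> L v -> L (mid u v)) -> (forall k, L (f k)) ->
  forall k, L (g k).
Proof.
by move=> gf Lm Lf k; apply: (midhull_stable Lm _ (gf k)) => _ [j _ <-].
Qed.

Lemma finer_mid_le g f x a : finer_mid g f ->
  (forall k, f k x <= a) -> forall k, g k x <= a.
Proof.
move=> gf fa; apply: (finer_mid_stable (L := [set u | u x <= a]) gf) => // u v /=.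
by rewrite /mid ler_pdivrMr//; lra.
Qed.

Lemma finer_mid_ge g f x a : finer_mid g f ->
  (forall k, a <= f k x) -> forall k, a <= g k x.
Proof.
move=> gf fa; apply: (finer_mid_stable (L := [set u | a <= u x]) gf) => // u v /=.
by rewrite /mid ler_pdivlMr//; lra.
Qed.

Lemma finer_mid_norm g f x a : finer_mid g f ->
  (forall k, `|f k x| <= a) -> forall k, `|g k x| <= a.
Proof.
move=> gf fa k; rewrite ler_norml; apply/andP; split.
  by apply: (finer_mid_ge gf) => j; have := fa j; rewrite ler_norml => /andP[].
by apply: (finer_mid_le gf) => j; have := fa j; rewrite ler_norml => /andP[].
Qed.

(** A version of limsup minus liminf being at least [d], phrased by values attained infinitely
    often, so that it passes from averages back to the sequence. *)
Definition osc (d : R) g x := exists a,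
  (forall N, exists2 k, (N <= k)%N & g k x <= a) /\
  (forall N, exists2 k, (N <= k)%N & a + d <= g k x).

Lemma finer_osc d g f x : finer_mid g f -> osc d g x -> osc d f x.
Proof.
move=> gf [a [ga gd]]; exists a; split=> N.
  have [k Nk /(midhull_le (gf k))[_ [j /= kj <-] fja]] := ga N.
  by exists j => //; exact: leq_trans kj.
have [k Nk /(midhull_ge (gf k))[_ [j /= kj <-] fja]] := gd N.
by exists j => //; exact: leq_trans kj.
Qed.

Lemma osc_skip d m g x : osc d g x -> osc d (skip m g) x.
Proof.
move=> [a [ga gd]]; exists a; split=> N.
  have [k Nk gk] := ga (N + m)%N; exists (k - m)%N.
    by rewrite leq_subRL ?(leq_trans _ Nk) ?leq_addl// addnC.
  by rewrite /skip subnK// (leq_trans _ Nk)// leq_addl.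
have [k Nk gk] := gd (N + m)%N; exists (k - m)%N.
  by rewrite leq_subRL ?(leq_trans _ Nk) ?leq_addl// addnC.
by rewrite /skip subnK// (leq_trans _ Nk)// leq_addl.
Qed.

Lemma cvgnP (u : nat -> R) (l : R) : u @ \oo --> l <->
  forall e : R, 0 < e -> exists N, forall k, (N <= k)%N -> `|l - u k| <= e.
Proof.
split=> [/cvgrPdist_le ul e e0|ul].
  by have [N _ uN] := ul e e0; exists N => k Nk; exact: uN.
apply/cvgrPdist_le => e e0; have [N uN] := ul e e0.
by exists N => // k /= Nk; exact: uN.
Qed.

Lemma not_osc_cvg g x M : (forall k, `|g k x| <= M) ->
  (forall d, 0 < d -> ~ osc d g x) -> exists l, g ^~ x @ \oo --> (l : R).
Proof.
move=> gM nosc.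
(* The supremum of [S] is the limit superior, which is the candidate for the limit. *)
pose S := [set a | forall N, exists2 k, (N <= k)%N & a <= g k x].
have S0 : S !=set0.
  by exists (- M) => N; exists N => //; have := gM N; rewrite ler_norml => /andP[].
have SM : ubound S M.
  move=> a /(_ 0%N)[k _ ak]; apply: (le_trans ak).
  by have := gM k; rewrite ler_norml => /andP[].
have supS : has_sup S by split => //; exists M.
exists (sup S); apply/cvgnP => e e0; apply: contrapT => nN.
have Sl N : exists2 k, (N <= k)%N & sup S - e / 2 <= g k x.
  have [a Sa sa] := sup_adherent (divr_gt0 e0 (ltr0n _ 2)) supS.
  by have [k Nk ak] := Sa N; exists k => //; apply: le_trans ak; exact: ltW.
have Su : exists N, forall k, (N <= k)%N -> g k x <= sup S + e.
  apply: contrapT => nNu.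
  have : S (sup S + e).
    move=> N; apply: contrapT => nk; apply: nNu; exists N => k Nk.
    rewrite leNgt; apply/negP => lt; apply: nk; exists k => //; exact: ltW.
  by move/(sup_upper_bound supS); rewrite gerDl leNgt e0.
apply: (nosc (e / 2)); first by rewrite divr_gt0.
(* If convergence to [sup S] fails by [e], values below [sup S - e] recur, and so do values above
   [sup S - e / 2]. *)
exists (sup S - e); split=> N; last first.
  by have [k Nk ak] := Sl N; exists k => //; apply: le_trans ak; lra.
apply: contrapT => nk; apply: nN; have [N' uN'] := Su; exists (maxn N N') => k.
rewrite geq_max => /andP[Nk N'k]; rewrite distrC ler_distl uN'// andbT leNgt.
by apply/negP => lt; apply: nk; exists k => //; exact: ltW.
Qed.

Lemma finer_cvg g f x (l : R) : finer_mid g f -> f ^~ x @ \oo --> l -> g ^~ x @ \oo --> l.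
Proof.
move=> gf /cvgnP fl; apply/cvgnP => e /fl[N fN]; exists N => k Nk.
rewrite distrC ler_distl; apply: (midhull_stable (L := [set u | l - e <= u x <= l + e]) _ _ (gf k)).
  move=> u v /= /andP[u1 u2] /andP[v1 v2]; rewrite /mid.
  by rewrite ler_pdivlMr// ler_pdivrMr//; apply/andP; split; lra.
move=> _ [j /= kj <-]; rewrite -ler_distl distrC; apply: fN.
exact: leq_trans kj.
Qed.

End midpoint_hull.

Lemma ultra_lim (R : realType) (U : set_system nat) (u : nat -> R) M :
  UltraFilter U -> (forall n, `|u n| <= M) -> exists l, u @ U --> (l : R).
Proof.
move=> UU uM; have UF : ProperFilter (u @ U) by exact: fmap_proper_filter.
have [|l [_ ucl]] := @segment_compact R (- M) M (u @ U).
  by rewrite /= nbhs_simpl /=; apply: filterE => n; rewrite /= in_itv /= -ler_norml.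
exists l => A /= Al; have [//|nA] := in_ultra_setVsetC (u @^-1` A) UU.
have [] := ucl (~` A) A _ Al; first by rewrite nbhs_simpl.
by move=> t [].
Qed.

(** * The splitting tree and its Bessel inequality *)

Section tree.
Context (R : realType) (V : Type) (L : set (V -> R)) (p : V -> R).
Hypothesis L_mid : forall u v, L u -> L v -> L (mid u v).
Hypothesis L_halfdiff : forall u v, L u -> L v -> L (fun x => (u x - v x) / 2).
Hypothesis L_lim : forall (U : set_system nat) (u : nat -> V -> R) (v : V -> R),
  ProperFilter U -> (forall n, L (u n)) ->
  (forall x, u ^~ x @ U --> v x) -> L v.

(* [h n.+1] is the half sum of two subsequences of [h n] separated by [d] at
   [y n]; [D n i] is the half difference made at stage [i], averaged along the
   later splittings.  The parallelogram identity gives [bessel]. *)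
Lemma osc_tree (d : R) (W : nat -> set V) (h0 : nat -> V -> R) :
  (forall k, L (h0 k)) -> (forall k x, `|h0 k x| <= p x) ->
  (forall m h, finer_mid h h0 -> exists2 x, W m x & osc d h x) ->
  exists (F : nat -> V -> R) (y : nat -> V), forall m,
    [/\ L (F m), W m (y m), d / 2 <= F m (y m) &
        forall x, \sum_(i < m) F i x ^+ 2 <= p x ^+ 2].
Proof.
move=> Lh0 ph0 Wh0.
have /choice[st stP] (mh : nat * (nat -> V -> R)) :
    exists s : V * (nat -> nat) * (nat -> nat), finer_mid mh.2 h0 ->
      [/\ W mh.1 s.1.1, forall k, (k <= s.1.2 k)%N /\ (k <= s.2 k)%N &
          forall k, d <= mh.2 (s.1.2 k) s.1.1 - mh.2 (s.2 k) s.1.1].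
  (* If [mh.2] does not refine [h0], default data are returned; [Wh0] then serves to produce some
     point of [V]. *)
  have [hh0|nh] := pselect (finer_mid mh.2 h0); last first.
    have [x _ _] := Wh0 0%N h0 (finer_refl (@midhull_sub _ _) _).
    by exists (x, id, id).
  have [x Wx [a [ha hd]]] := Wh0 mh.1 mh.2 hh0.
  have {hd}/choice[K1 K1P] k : exists j, (k <= j)%N /\ a + d <= mh.2 j x.
    by have [j] := hd k; exists j.
  have {ha}/choice[K2 K2P] k : exists j, (k <= j)%N /\ mh.2 j x <= a.
    by have [j] := ha k; exists j.
  exists (x, K1, K2) => _; split=> //= k.
    by split; [have [] := K1P k|have [] := K2P k].
  by have [_ ?] := K1P k; have [_ ?] := K2P k; lra.
pose h := fix h m : nat -> V -> R := if m is m'.+1 then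
    let s := st (m', h m') in fun k => mid (h m' (s.1.2 k)) (h m' (s.2 k))
  else h0.
pose K1 m := (st (m, h m)).1.2; pose K2 m := (st (m, h m)).2.
pose y m := (st (m, h m)).1.1.
have hS m k : h m.+1 k = mid (h m (K1 m k)) (h m (K2 m k)) by [].
have hh0 m : finer_mid (h m) h0.
  elim: m => [|m ih]; first by apply: finer_refl; exact: midhull_sub.
  have [_ Kk _] := stP (m, h m) ih.
  apply: (finer_trans (@midhull_sub _ _) (@midhull_min _ _) ih).
  by move=> k; have [? ?] := Kk k; apply: midhull_mid; apply: midhull_base;
     [exists (K1 m k)|exists (K2 m k)].
have Wy m : W m (y m) by have [] := stP (m, h m) (hh0 m).
have yd m k : d <= h m (K1 m k) (y m) - h m (K2 m k) (y m).
  by have [_ _] := stP (m, h m) (hh0 m); exact.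
have Lh m k : L (h m k) by exact: (finer_mid_stable (hh0 m)).
(* The base value is the zero function, written as a half difference so that it lies in [L]. *)
pose D := fix D n (i k : nat) : V -> R := if n is n'.+1 then
    if (i == n')%N then fun x => (h n' (K1 n' k) x - h n' (K2 n' k) x) / 2
    else mid (D n' i (K1 n' k)) (D n' i (K2 n' k))
  else fun x => (h0 0 x - h0 0 x) / 2.
have LD n i k : L (D n i k).
  elim: n i k => [|n ih] i k /=; first exact: L_halfdiff.
  by case: eqP => _; [exact: L_halfdiff|exact: L_mid].
have hp m k x : `|h m k x| <= p x.
  elim: m k => [//|m ih] k; rewrite hS /mid.
  have := ih (K1 m k); have := ih (K2 m k); rewrite !ler_norml => /andP[? ?] /andP[? ?].
  by apply/andP; split; lra.
have Dp n i k x : `|D n i k x| <= p x.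
  elim: n i k => [|n ih] i k /=.
    by rewrite subrr mul0r normr0 (le_trans _ (ph0 0%N x)).
  case: eqP => _.
    have := hp n (K1 n k) x; have := hp n (K2 n k) x.
    by rewrite !ler_norml => /andP[? ?] /andP[? ?]; apply/andP; split; lra.
  have := ih i (K1 n k); have := ih i (K2 n k); rewrite /mid.
  by rewrite !ler_norml => /andP[? ?] /andP[? ?]; apply/andP; split; lra.
have Dy n i k : (i < n)%N -> d / 2 <= D n i k (y i).
  elim: n k => [//|n ih] k; rewrite ltnS leq_eqVlt /= => /predU1P[->|ilt].
    by rewrite eqxx; have := yd n k; lra.
  rewrite (ltn_eqF ilt) /mid; have := ih (K1 n k) ilt; have := ih (K2 n k) ilt; lra.
have bessel n k x : h n k x ^+ 2 + \sum_(i < n) D n i k x ^+ 2 <= p x ^+ 2.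
  elim: n k => [|n ih] k.
    rewrite big_ord0 addr0 -[h 0 k x ^+ 2]real_normK ?num_real// lerXn2r// ?nnegrE//.
    by rewrite (le_trans _ (hp 0%N k x)).
  rewrite big_ord_recr hS /= eqxx.
  have := lerD (ih (K1 n k)) (ih (K2 n k)); rewrite addrACA -big_split /=.
  set S := \sum_(i < n) (_ + _); set S' := \sum_(i < n) _.
  (* The functionals stored earlier are averaged, and the square of a mean is at most the mean of
     the squares. *)
  have SS' : S' * 2 <= S.
    rewrite /S' mulr_suml; apply: ler_sum => i _; rewrite (ltn_eqF (ltn_ord i)) /mid.
    have := sqr_ge0 (D n i (K1 n k) x - D n i (K2 n k) x); nra.
  move=> hS'; rewrite /mid; nra.
(* The number of stages now tends to infinity. An ultrafilter gives pointwise limits at all points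
   of [V] at once, where a diagonal subsequence would require countability. *)
have [U [UU Uoo]] := @ultraFilterLemma _ \oo _.
have [F FP] : exists F : nat -> V -> R, forall m x, (fun n => D n m 0 x) @ U --> F m x.
  have /choice[F FP] mx : exists l, (fun n => D n mx.1 0 mx.2) @ U --> (l : R).
    exact: (@ultra_lim _ _ _ (p mx.2)).
  by exists (fun m x => F (m, x)) => m x; exact: (FP (m, x)).
have UP : ProperFilter U by exact: ultra_proper.
exists F, y => m; split=> //.
- by apply: (L_lim UP _ (FP m)).
- apply: (cvgr_to_ge (FP m (y m))); apply: Uoo; exists m.+1 => // n /= mn.
  exact: Dy.
- move=> x.
  have : (fun n => \sum_(i < m) D n i 0 x ^+ 2) @ U --> \sum_(i < m) F i x ^+ 2.
    by apply: cvg_big => [|i _]; [exact: add_continuous|rewrite expr2; apply: cvgM; exact: FP].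
  move=> /cvgr_to_le; apply; apply: Uoo; exists m => // n /= mn.
  have := bessel n 0%N x; apply: le_trans.
  rewrite ler_wpDl ?sqr_ge0//.
  rewrite -(big_mkord xpredT (fun i => D n i 0 x ^+ 2)).
  rewrite -(big_mkord xpredT (fun i => D n i 0 x ^+ 2)).
  by rewrite (big_cat_nat (leq0n m) mn)//= lerDl sumr_ge0// => i _; exact: sqr_ge0.
Qed.

(** The partial sums of squares from [osc_tree] are bounded, so the squares [F m x ^+ 2] form a
    convergent series and tend to zero at every point. *)
Lemma osc_null_sequence (d : R) (W : nat -> set V) (h0 : nat -> V -> R) :
  (forall k, L (h0 k)) -> (forall k x, `|h0 k x| <= p x) ->
  (forall m h, finer_mid h h0 -> exists2 x, W m x & osc d h x) ->
  exists (F : nat -> V -> R) (y : nat -> V),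
    [/\ forall m, L (F m), forall m x, `|F m x| <= p x,
        forall x, F ^~ x @ \oo --> (0 : R),
        forall m, W m (y m) & forall m, d / 2 <= F m (y m)].
Proof.
move=> Lh0 ph0 Wh0; have [F [y FyP]] := osc_tree Lh0 ph0 Wh0.
have p0 x : 0 <= p x by exact: le_trans (ph0 0%N x).
exists F, y; split.
- by move=> m; have [] := FyP m.
- move=> m x; rewrite -ler_sqr ?nnegrE// real_normK ?num_real//.
  have [_ _ _ /(_ x)] := FyP m.+1; apply: le_trans.
  by rewrite big_ord_recr /= lerDr sumr_ge0// => i _; exact: sqr_ge0.
- move=> x.
  have sq0 : (fun m => F m x ^+ 2) @ \oo --> (0 : R).
    apply: cvg_series_cvg_0; apply: nondecreasing_is_cvgn.
      by apply: nondecreasing_series => i _ _; exact: sqr_ge0.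
    exists (p x ^+ 2) => _ [m _ <-]; rewrite seriesEord.
    by have [_ _ _] := FyP m; exact.
  apply/cvgnP => e e0; move/cvgnP : sq0 => /(_ (e ^+ 2)).
  rewrite exprn_gt0// => /(_ isT)[N NF]; exists N => k Nk; rewrite -ler_sqr ?nnegrE ?(ltW e0)//.
  by have := NF k Nk; rewrite !sub0r !normrN normrX.
- by move=> m; have [_ Wm _ _] := FyP m.
- by move=> m; have [_ _ dF _] := FyP m.
Qed.

End tree.

(** * Convergent averages and convergent subsequences *)

Section core.
Context (R : realType) (V : Type) (L : set (V -> R)) (p : nat -> V -> R).
Hypothesis L_mid : forall u v, L u -> L v -> L (mid u v).
Hypothesis L_halfdiff : forall u v, L u -> L v -> L (fun x => (u x - v x) / 2).
Hypothesis L_sub : forall u v, L u -> L v -> L (fun x => u x - v x).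
Hypothesis L_lim : forall (U : set_system nat) (u : nat -> V -> R) (v : V -> R),
  ProperFilter U -> (forall n, L (u n)) ->
  (forall x, u ^~ x @ U --> v x) -> L v.

Definition seq_bounded (y : nat -> V) :=
  forall j, exists M, forall k, p j (y k) <= M.

(** The factor 2 admits differences of two functions that are each dominated by [p 0]. *)
Hypothesis null_uniform : forall g : nat -> V -> R,
  (forall k, L (g k)) -> (forall k x, `|g k x| <= 2 * p 0 x) ->
  (forall x, g ^~ x @ \oo --> (0 : R)) ->
  forall y, seq_bounded y -> (fun k => g k (y k)) @ \oo --> (0 : R).

(** Natural radii on finitely many of the [p j] give only countably many boxes, so boxes can index a
    stabilization. *)
Let box (s : seq nat) : set V :=
  [set x | forall j, (j < size s)%N -> p j x <= (nth 0%N s j)%:R].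

Lemma box_seq_bounded (r : nat -> nat) (y : nat -> V) :
  (forall k, box (mkseq r k) (y k)) -> seq_bounded y.
Proof.
(* The radius [r j] constrains [y k] only for [j < k]; the finite sum covers the earlier terms. *)
move=> ry j; exists ((r j)%:R + \sum_(k < j.+1) `|p j (y k)|) => k.
have [kj|jk] := ltnP k j.+1.
  rewrite (bigD1 (Ordinal kj))//= addrCA (le_trans (ler_norm _))// lerDl.
  by rewrite addr_ge0// sumr_ge0.
have := ry k j; rewrite size_mkseq nth_mkseq// => /(_ jk) /le_trans; apply.
by rewrite lerDl sumr_ge0.
Qed.

(** Stabilize the properties that no point of a given box has oscillation [1 / (i + 1)]. Without
    convergence some [i] fails on the whole of [V], hence for all refinements; suitable radii
    confine the oscillation points to growing boxes, and [osc_null_sequence] then contradicts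
    uniform nullity along a bounded sequence. *)
Lemma midblock_cvg f : (forall k, L (f k)) -> (forall k x, `|f k x| <= p 0 x) ->
  exists2 g, finer_mid g f & exists2 h, L h & forall x, g ^~ x @ \oo --> h x.
Proof.
move=> Lf fp; apply: contrapT => ncvg.
pose P (t : nat * seq nat) g := forall x, box t.2 x -> ~ @osc R V t.1.+1%:R^-1 g x.
have [||g gf gP] := @finer_stabilize _ _ (@midhull_sub R V) (@midhull_min R V) _ P f.
- by move=> i g h hg Pg x bx /(finer_osc hg); exact: Pg.
- by move=> i m h Ph x bx ho; apply: (Ph x bx); exact: osc_skip.
have Lg k : L (g k) by exact: (finer_mid_stable gf).
have gp k x : `|g k x| <= p 0 x by exact: (finer_mid_norm gf).
have [i nPi] : exists i, ~ P (i, [::]) g.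
  apply: contrapT => nP; apply: ncvg; exists g => //.
  have /choice[h hP] x : exists l, g ^~ x @ \oo --> (l : R).
    apply: (not_osc_cvg (gp^~ x)) => d d0 [a [ha hd]].
    have [i id] := invS_le d0; apply: nP; exists i => /(_ x); apply => //.
    exists a; split=> // N; have [k Nk ak] := hd N; exists k => //.
    by rewrite (le_trans _ ak)// lerD2l.
  by exists h => //; apply: (L_lim _ Lg hP).
pose Q s := forall g', finer_mid g' g -> exists2 x, box s x & osc i.+1%:R^-1 g' x.
have QP s : ~ P (i, s) g -> Q s.
  case: (gP (i, s)) => // nP _ g' /nP /existsNP[x /not_implyP[bx /contrapT]].
  by exists x.
(* One more radius can always be imposed: a point [x] of the current box where [g] oscillates
   satisfies the next constraint as soon as the radius exceeds [p (size l) x]. *)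
have [l|r rP] := @history_choice _ (fun l r => Q l -> Q (rcons l r)).
  have [Ql|] := pselect (Q l); last by exists 0%N.
  apply: contrapT => nr.
  have [x bx] := Ql g (finer_refl (@midhull_sub _ _) _).
  suff : ~ osc i.+1%:R^-1 g x by [].
  pose r := Num.bound `|p (size l) x|.
  have : ~ Q (rcons l r) by move=> Qr; apply: nr; exists r.
  move=> /(contra_not (@QP _))/contrapT; apply => j; rewrite size_rcons ltnS nth_rcons.
  rewrite leq_eqVlt => /predU1P[->|jl]; last by rewrite jl; exact: bx.
  by rewrite ltnn eqxx (le_trans (ler_norm _))// ltW// archi_boundP.
have Qr n : Q (mkseq r n) by elim: n => [|n /rP]; [exact: QP|rewrite -mkseqS].
have [F [y [LF Fp F0 Wy dF]]] := osc_null_sequence L_mid L_halfdiff L_lim Lg gp Qr.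
(* The values [F k (y k)] are at least half of [i.+1%:R^-1], so a quarter of it yields a
   contradiction. *)
have /cvgnP/(_ (i.+1%:R^-1 / 4)) : (fun k => F k (y k)) @ \oo --> (0 : R).
  apply: null_uniform => //.
    by move=> k x; rewrite (le_trans (Fp k x))// ler_peMl ?ler1n// (le_trans _ (Fp k x)).
  exact: (@box_seq_bounded r).
have i0 : 0 < i.+1%:R^-1 :> R by [].
rewrite divr_gt0// => /(_ isT)[N /(_ N (leqnn _))].
rewrite sub0r normrN ler_norml => /andP[_ FN].
have {}dF := dF N; move: i0 FN dF; move: (_^-1) (F N (y N)) => e z; lra.
Qed.

Theorem subsequence_cvg f : (forall k, L (f k)) -> (forall k x, `|f k x| <= p 0 x) ->
  exists2 g, finer_sub g f & exists2 h, L h & forall x, g ^~ x @ \oo --> h x.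
Proof.
move=> Lf fp.
(* [P t g] says that no limit of averages of [g] is in [O t], i.e. close to the
   average [t.1.1] of [f] on the box [t.1.2]. *)
pose O (t : GenTree.tree nat * seq nat * nat) : set (V -> R) :=
  [set h | forall x, box t.1.2 x -> `|h x - midtree_eval f t.1.1 x| <= t.2.+1%:R^-1].
pose P t (g : nat -> V -> R) := forall g' (h : V -> R), finer_mid g' g ->
  (forall x, g' ^~ x @ \oo --> h x) -> ~ O t h.
have sub_trans g1 g2 g3 : finer_mid g3 g2 -> finer_sub g2 g1 -> finer_mid g3 g1.
  move=> g32 /finer_sub_mid g21.
  exact: (finer_trans (@midhull_sub _ _) (@midhull_min _ _) g21).
have id_sub (A : set (V -> R)) : A `<=` id A by [].
have id_min (A B : set (V -> R)) : A `<=` id B -> id A `<=` id B by [].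
have [||g gf gP] := @finer_stabilize _ id id_sub id_min _ P f.
- by move=> t g g' g'g Pg g'' h g''g'; apply: Pg; exact: sub_trans g'g.
- move=> t m g Pg g' h g'g g'h; apply: (Pg (skip m g')).
    exact: (skip_finer (@midhull_sub _ _) (@midhull_min _ _)).
  move=> x; apply: finer_cvg (g'h x); apply: (finer_skip (@midhull_sub _ _)).
have /finer_subP gE := gf.
have Lg k : L (g k) by have [j _ ->] := gE k.
have gp k x : `|g k x| <= p 0 x by have [j _ ->] := gE k.
have block_lim g' : finer_sub g' g -> exists g'' h, [/\ finer_mid g'' g',
    forall k, L (g'' k), forall k x, `|g'' k x| <= p 0 x, L h &
    forall x, g'' ^~ x @ \oo --> h x].
  move=> /finer_subP g'E.
  have Lg' k : L (g' k) by have [j _ ->] := g'E k.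
  have g'p k x : `|g' k x| <= p 0 x by have [j _ ->] := g'E k.
  have [g'' g''g' [h Lh hP]] := midblock_cvg Lg' g'p.
  exists g'', h; split=> // [k|k x]; first exact: (finer_mid_stable g''g').
  exact: (finer_mid_norm g''g').
suff /choice[h hP] x : exists l, g ^~ x @ \oo --> (l : R).
  by exists g => //; exists h => //; exact: (L_lim _ Lg hP).
apply: (not_osc_cvg (gp^~ x)) => d d0 [a [ga gd]].
(* Two approximation errors of at most [d / 4] cannot bridge a gap of [d]. *)
have [i id4] := invS_le (divr_gt0 d0 (ltr0n _ 4)).
have {ga}/choice[ka kaP] N : exists k, (N <= k)%N /\ g k x <= a.
  by have [k] := ga N; exists k.
have {gd}/choice[kb kbP] N : exists k, (N <= k)%N /\ a + d <= g k x.
  by have [k] := gd N; exists k.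
pose ga k := g (ka k); pose gb k := g (kb k).
have gag : finer_sub ga g by apply/finer_subP => k; exists (ka k) => //; have [] := kaP k.
have gbg : finer_sub gb g by apply/finer_subP => k; exists (kb k) => //; have [] := kbP k.
have [gb' [hb [gb'gb Lgb' gb'p Lhb gb'hb]]] := block_lim _ gbg.
have hbp y : `|hb y| <= p 0 y.
  by apply: (cvgr_to_le (cvg_norm (gb'hb y))); exact: nearW.
(* These radii keep the oscillation point [x] in every box. *)
pose r j := Num.bound `|p j x|.
have xbox k : box (mkseq r k) x.
  move=> j; rewrite size_mkseq => jk; rewrite nth_mkseq//.
  by rewrite (le_trans (ler_norm _))// ltW// archi_boundP.
(* Otherwise points [y k] of the growing boxes would witness that the null sequence [hb - gb' k] is
   not uniformly null along a bounded sequence. *)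
have [k bk] : exists k, forall y, box (mkseq r k) y -> `|hb y - gb' k y| <= i.+1%:R^-1.
  apply: contrapT => /forallNP nk.
  have /choice[y yP] k : exists y, box (mkseq r k) y /\ i.+1%:R^-1 < `|hb y - gb' k y|.
    have /existsNP[y /not_implyP[by_ /negP]] := nk k.
    by rewrite -ltNge; exists y.
  have : (fun k => hb (y k) - gb' k (y k)) @ \oo --> (0 : R).
    apply: (@null_uniform (fun k x => hb x - gb' k x)).
    - by move=> k; exact: L_sub.
    - move=> k z; rewrite (le_trans (ler_normB _ _))// mulr_natl mulr2n lerD//.
    - move=> z; rewrite -[X in _ --> X](subrr (hb z)); apply: cvgB => //; exact: cvg_cst.
    - by apply: (@box_seq_bounded r) => k; have [] := yP k.
  move=> /cvgnP/(_ i.+1%:R^-1)[//|N /(_ N (leqnn _))].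
  by rewrite sub0r normrN leNgt; have [_ ->] := yP N.
(* An average of a subsequence of [g] is also an average of [f], so it belongs to the countable
   index set of the stabilization. *)
have [t tE] : exists t, gb' k = midtree_eval f t.
  apply: midhull_midtree; apply: (midhull_min _ (gb'gb k)) => _ [j _ <-].
  by apply: midhull_sub; have [j' _ gj'] := gE (kb j); exists j'.
have hbO : O (t, mkseq r k, i) hb by move=> y /bk; rewrite /= -tE.
(* The limit [hb] refutes the first alternative. By the second, averages of [ga] also have a limit
   [h'] in the same set [O], although [h' x <= a] and [a + d <= hb x]. *)
have [Pg|nP] := gP (t, mkseq r k, i).
  apply: (Pg gb' hb) => //; exact: sub_trans gbg.
apply: (nP _ gag) => g' h' g'ga g'h' Oh'.
have h'x : h' x <= a.
  apply: (cvgr_to_le (g'h' x)); apply: nearW => n.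
  by apply: (finer_mid_le g'ga) => m; have [] := kaP m.
have hbx : a + d <= hb x.
  apply: (cvgr_to_ge (gb'hb x)); apply: nearW => n.
  by apply: (finer_mid_ge gb'gb) => m; have [] := kbP m.
have := hbO x (xbox k); have := Oh' x (xbox k) => /=; rewrite !ler_distl.
move=> /andP[h1 h2] /andP[h3 h4]; move: hbx h'x id4 d0 h1 h2 h3 h4.
move: (midtree_eval f t x) (hb x) (h' x) (i.+1%:R^-1) => q b c e; lra.
Qed.

End core.

(** * Hahn-Banach over the real and complex numbers *)

Section hahn_banach.
Context (R : realType) (W : lmodType R) (p : W -> R).
Hypothesis pD : forall x y, p (x + y) <= p x + p y.
Hypothesis pZ : forall a x, p (a *: x) = `|a| * p x.

Let p0 : p 0 = 0. Proof. by rewrite -(scale0r 0) pZ normr0 mul0r. Qed.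
Let pN x : p (- x) = p x. Proof. by rewrite -scaleN1r pZ normrN1 mul1r. Qed.

Let linear_graph (G : set (W * R)) := forall a u v,
  G u -> G v -> G (a *: u.1 + v.1, a * u.2 + v.2).
Let dominated (G : set (W * R)) := forall u, G u -> u.2 <= p u.1.

Let graph_extend (G : set (W * R)) x0 c : set (W * R) :=
  [set (u.1 + t *: x0, u.2 + t * c) | t in setT & u in G].

Let linear_extend G x0 c : linear_graph G -> linear_graph (graph_extend G x0 c).
Proof.
move=> Gl a _ _ [t _ [u Gu <-]] [s _ [v Gv <-]] /=.
exists (a * t + s) => //; exists (a *: u.1 + v.1, a * u.2 + v.2); first exact: Gl.
congr (_, _); first by rewrite scalerDr scalerDl scalerA addrACA.
by rewrite mulrDr mulrDl mulrA addrACA.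
Qed.

(** By homogeneity of [p], only the coefficients 1 and -1 of [x0] have to be checked; these are the
    two bounds on [c]. *)
Let dominated_extend G x0 c : linear_graph G -> dominated G ->
  (forall u, G u -> u.2 - p (u.1 - x0) <= c) ->
  (forall u, G u -> c <= p (u.1 + x0) - u.2) -> dominated (graph_extend G x0 c).
Proof.
move=> Gl Gp cl cu _ [t _ [u Gu <-]] /=.
have G00 : G (0, 0).
  by have := Gl (-1) _ _ Gu Gu; rewrite scaleN1r mulN1r !addNr.
have Gs s : G (s *: u.1, s * u.2).
  by have := Gl s _ _ Gu G00; rewrite !addr0.
have [t0|t0|->] := ltgtP t 0; last by rewrite scale0r mul0r !addr0 Gp.
- have nt0 : 0 < - t by rewrite oppr_gt0.
  have := cl _ (Gs (- t)^-1) => /=.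
  rewrite -(ler_pM2l nt0) mulrBr mulrA divff ?gt_eqF// mul1r.
  rewrite -[X in _ - X * p _](gtr0_norm nt0) -pZ scalerBr scalerA divff ?gt_eqF//.
  by rewrite scale1r scaleNr opprK; lra.
- have := cu _ (Gs t^-1) => /=.
  rewrite -(ler_pM2l t0) mulrBr mulrA divff ?gt_eqF// mul1r.
  rewrite -[X in X * p _](gtr0_norm t0) -pZ scalerDr scalerA divff ?gt_eqF//.
  by rewrite scale1r; lra.
Qed.

Theorem hahn_banach z : exists f : W -> R,
  [/\ linear (f : W -> R^o), forall x, `|f x| <= p x & f z = p z].
Proof.
pose z0 := (z, p z).
pose P (G : set (W * R)) := [/\ linear_graph G, dominated G & G = set0 \/ G z0].
have [|A [[Al Ap Az] maxA]] := @Zorn_bigcup _ P.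
  move=> F FP Ftot; split.
  - move=> a u v [X FX Xu] [Y FY Yv].
    have [XY|YX] := Ftot _ _ FX FY; [exists Y|exists X] => //.
      by have [Gl _ _] := FP _ FY; apply: Gl => //; exact: XY.
    by have [Gl _ _] := FP _ FX; apply: Gl => //; exact: YX.
  - by move=> u [X FX Xu]; have [_ + _] := FP _ FX; exact.
  - have [[X [FX Xz]]|nz] := pselect (exists X, F X /\ X z0).
      by right; exists X.
    left; apply/seteqP; split=> // u [X FX Xu].
    have [_ _ [X0|Xz]] := FP _ FX; first by rewrite -X0.
    by apply: nz; exists X.
have {}Az : A z0.
  case: Az => // A0.
  pose B : set (W * R) := [set (t *: z, t * p z) | t in setT].
  exfalso; apply: (maxA B); last split.
  - rewrite A0; split=> // /(_ z0); apply; exists 1 => //.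
    by rewrite scale1r mul1r.
  - move=> a _ _ [t _ <-] [s _ <-]; exists (a * t + s) => //=.
    by rewrite scalerDl mulrDl scalerA mulrA.
  - move=> _ [t _ <-] /=; rewrite pZ ler_wpM2r ?ler_norm//.
    have := pD z (- z); rewrite subrr p0 pN; lra.
  - by right; exists 1 => //; rewrite scale1r mul1r.
have A00 : A (0, 0).
  by have := Al (-1) _ _ Az Az; rewrite scaleN1r mulN1r !addNr.
have Ainj x r s : A (x, r) -> A (x, s) -> r = s.
  move=> Ar As; apply/eqP; rewrite eq_le; apply/andP; split.
    have := Ap _ (Al (-1) _ _ As Ar); rewrite /= scaleN1r addNr p0; lra.
  have := Ap _ (Al (-1) _ _ Ar As); rewrite /= scaleN1r addNr p0; lra.
have /choice[f fP] x0 : exists r, A (x0, r).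
  apply: contrapT => /forallNP nx0.
  (* Any value at [x0] between these lower bounds and the upper bounds [p (v.1 + x0) - v.2] extends
     the graph; [sup S] is such a value. *)
  pose S := [set u.2 - p (u.1 - x0) | u in A].
  have Sle u v : A u -> A v -> u.2 - p (u.1 - x0) <= p (v.1 + x0) - v.2.
    move=> Au Av; have := Ap _ (Al 1 _ _ Au Av); rewrite /= scale1r mul1r.
    have := pD (u.1 - x0) (v.1 + x0); rewrite [v.1 + x0]addrC addrA subrK; lra.
  have S0 : S !=set0 by exists (0 - p (0 - x0)), (0, 0).
  have supS : has_sup S.
    by split => //; exists (p (0 + x0) - 0) => _ [u Au <-]; exact: (Sle u (0, 0)).
  pose B := graph_extend A x0 (sup S).
  apply: (maxA B); last split.
  - split=> [u Au|].
      by exists 0 => //; exists u => //; rewrite scale0r mul0r !addr0; case: u {Au}.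
    move=> /(_ (x0, sup S)) BA; apply: (nx0 (sup S)); apply: BA.
    by exists 1 => //; exists (0, 0) => //; rewrite scale1r mul1r !add0r.
  - exact: linear_extend.
  - apply: dominated_extend => // u Au; first by apply: (sup_upper_bound supS); exists u.
    by apply: ge_sup => // _ [v Av <-]; exact: Sle.
  - by right; exists 0 => //; exists z0 => //; rewrite scale0r mul0r !addr0.
exists f; split=> [a x y|x|].
- exact: (Ainj _ _ _ (fP _) (Al a _ _ (fP x) (fP y))).
- rewrite ler_norml (Ap _ (fP x)) andbT lerNl.
  have := Ap _ (Al (-1) _ _ (fP x) A00); rewrite /= scaleN1r mulN1r !addr0 pN; exact.
- exact: Ainj (fP z) Az.
Qed.

End hahn_banach.

(** * Real and complex scalars treated uniformly *)

Definition restrict_scalars (S T : pzRingType) (phi : {rmorphism S -> T})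
  (W : lmodType T) : Type := W.

Section restrict_scalars.
Context (S T : pzRingType) (phi : {rmorphism S -> T}) (W : lmodType T).
Local Notation V := (restrict_scalars phi W).
HB.instance Definition _ := GRing.Zmodule.copy V W.
Definition restrict_scale (a : S) (x : V) : V := phi a *: (x : W).
Fact restrict_scaleA a b x : restrict_scale a (restrict_scale b x) = restrict_scale (a * b) x.
Proof. by rewrite /restrict_scale scalerA rmorphM. Qed.
Fact restrict_scale1 : left_id 1 restrict_scale.
Proof. by move=> x; rewrite /restrict_scale rmorph1 scale1r. Qed.
Fact restrict_scaleDr : right_distributive restrict_scale +%R.
Proof. by move=> a x y; rewrite /restrict_scale scalerDr. Qed.
Fact restrict_scaleDl x : {morph restrict_scale^~ x : a b / a + b}.
Proof. by move=> a b; rewrite /restrict_scale rmorphD scalerDl. Qed.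
HB.instance Definition _ := GRing.Zmodule_isLmodule.Build S V
  restrict_scaleA restrict_scale1 restrict_scaleDr restrict_scaleDl.
Lemma restrict_scalarsE (a : S) (x : V) : a *: x = phi a *: (x : W) :> W.
Proof. by []. Qed.
End restrict_scalars.

(* [im_unit] is [i] if [K] is complex, and [0] if [K] is real. *)
Record scalars (R : realType) (K : numFieldType) := Scalars {
  inR : {rmorphism R -> K};
  re : K -> R;
  nrm : K -> R;
  im_unit : K;
  inR_le : forall a b, (inR a <= inR b) = (a <= b);
  re_linear : forall a x y, re (inR a * x + y) = a * re x + re y;
  re_le_nrm : forall x, `|re x| <= nrm x;
  nrmE : forall x, `|x| = inR (nrm x);
  re_inR : forall a, re (inR a) = a;
  re_im : forall a, re (im_unit * inR a) = 0;
  scalarE : forall z, z = inR (re z) - im_unit * inR (re (im_unit * z));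
  im_unit_sqr : im_unit = 0 \/ im_unit * im_unit = -1 }.

Lemma real_or_complexP (R : realType) (K : numFieldType) :
  real_or_complex R K -> inhabited (scalars R K).
Proof.
case; constructor.
  apply: (@Scalars R R idfun id Num.norm 0) => //=.
  - by move=> a; rewrite mul0r.
  - by move=> z; rewrite mul0r subr0.
  - by left.
apply: (@Scalars R R[i] (real_complex R) (@complex.Re R) (@Normc.normc R) 'i%C) => //.
- by move=> a b; exact: lecR.
- by move=> a [x y] [z t] /=; rewrite mul0r subr0.
- move=> [x y] /=; rewrite -sqrtr_sqr ler_wsqrtr// lerDl sqr_ge0//.
- by move=> a /=; rewrite !mul0r mulr0 subr0.
- move=> [x y]; apply/eqP; rewrite eq_complex /=.
  by rewrite !(mul0r, mul1r, mulr0, sub0r, subr0, add0r, addr0, opprK, oppr0) !eqxx.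
- by right; rewrite -expr2 sqr_i.
Qed.

Section absolutely_convex.
Context (K : numFieldType) (V : lmodType K) (U : set V).
Hypothesis Uc : absolutely_convex U.

Lemma absolutely_convexZ (t : K) x : `|t| <= 1 -> U x -> U (t *: x).
Proof.
move=> t1 Ux; have := Uc (a := t) (b := 0) Ux Ux.
by rewrite normr0 addr0 scale0r addr0; exact.
Qed.

Lemma absolutely_convex0 x : U x -> U 0.
Proof. by move=> Ux; rewrite -(scale0r x); apply: absolutely_convexZ; rewrite ?normr0. Qed.

Lemma absolutely_convexN x : U x -> U (- x).
Proof. by move=> Ux; rewrite -scaleN1r; apply: absolutely_convexZ; rewrite ?normrN1. Qed.

End absolutely_convex.

Section scalars_theory.
Context (R : realType) (K : numFieldType) (s : scalars R K).
Local Notation phi := (inR s).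
Local Notation re := (re s).
Local Notation nrm := (nrm s).
Local Notation j := (im_unit s).

Lemma inR_inj : injective phi.
Proof. by move=> a b ab; apply/eqP; rewrite eq_le -!(inR_le s) ab lexx. Qed.

Lemma inR_lt a b : (phi a < phi b) = (a < b).
Proof. by rewrite !lt_neqAle inR_le (inj_eq inR_inj). Qed.

Lemma nrm_ge0 z : 0 <= nrm z.
Proof. by rewrite -(inR_le s) -(nrmE s) rmorph0. Qed.

Lemma nrm_inR a : nrm (phi a) = `|a|.
Proof.
apply: inR_inj; rewrite -(nrmE s); have [a0|/ltW a0] := leP 0 a.
  by rewrite !ger0_norm// -(rmorph0 phi) inR_le.
by rewrite !ler0_norm ?rmorphN// -(rmorph0 phi) inR_le.
Qed.

Lemma nrmM x y : nrm (x * y) = nrm x * nrm y.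
Proof. by apply: inR_inj; rewrite rmorphM -!(nrmE s) normrM. Qed.

Lemma nrmD x y : nrm (x + y) <= nrm x + nrm y.
Proof. by rewrite -(inR_le s) rmorphD -!(nrmE s) ler_normD. Qed.

Lemma nrmN x : nrm (- x) = nrm x.
Proof. by apply: inR_inj; rewrite -!(nrmE s) normrN. Qed.

Lemma nrm0 : nrm 0 = 0.
Proof. by apply: inR_inj; rewrite -(nrmE s) normr0 rmorph0. Qed.

Lemma nrm1 : nrm 1 = 1.
Proof. by apply: inR_inj; rewrite -(nrmE s) normr1 rmorph1. Qed.

Lemma nrmV x : nrm x^-1 = (nrm x)^-1.
Proof. by apply: inR_inj; rewrite -(nrmE s) normfV (nrmE s) fmorphV. Qed.

Lemma nrm_gt0 x : (0 < nrm x) = (x != 0).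
Proof. by rewrite -inR_lt rmorph0 -(nrmE s) normr_gt0. Qed.

Lemma normr_le_inR x r : (`|x| <= phi r) = (nrm x <= r).
Proof. by rewrite (nrmE s) inR_le. Qed.

Lemma normr_le1 x : (`|x| <= 1) = (nrm x <= 1).
Proof. by rewrite -(rmorph1 phi) normr_le_inR. Qed.

Lemma inR_gt0 r : (0 < phi r) = (0 < r).
Proof. by rewrite -(rmorph0 phi) inR_lt. Qed.

Lemma gt0_inR e : 0 < e -> exists2 r, 0 < r & e = phi r.
Proof.
by move=> e0; exists (nrm e); rewrite ?nrm_gt0 ?gt_eqF// -(nrmE s) gtr0_norm.
Qed.

Lemma inR_nat n : phi n%:R = n%:R.
Proof. exact: rmorph_nat. Qed.

Lemma re0 : re 0 = 0.
Proof. by rewrite -(rmorph0 phi) re_inR. Qed.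

Lemma reD x y : re (x + y) = re x + re y.
Proof. by have := re_linear s 1 x y; rewrite rmorph1 !mul1r. Qed.

(** Rotating [z] onto the positive axis turns bounds on real parts into bounds on moduli. *)
Lemma phase z : exists2 v, nrm v = 1 & re (v * z) = nrm z.
Proof.
have [->|z0] := eqVneq z 0; first by exists 1; rewrite ?nrm1// mulr0 re0 nrm0.
exists (phi (nrm z) / z).
  by rewrite nrmM nrmV nrm_inR ger0_norm ?nrm_ge0// divff// gt_eqF// nrm_gt0.
by rewrite divfK// re_inR.
Qed.

Section complexify.
Context (W : lmodType K) (u : W -> R).
Hypothesis ul : forall a x y, u (phi a *: x + y) = a * u x + u y.

(** The [K]-linear functional with real part [u]; for real scalars [j] is zero and [u] itself
    remains. *)
Definition complexify (x : W) : K := phi (u x) - j * phi (u (j *: x)).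

Let u0 : u 0 = 0.
Proof.
have := ul 1 0 0; rewrite rmorph1 scale1r addr0 mul1r => h.
by apply: (addrI (u 0)); rewrite addr0.
Qed.

Let uD x y : u (x + y) = u x + u y.
Proof. by have := ul 1 x y; rewrite rmorph1 scale1r mul1r. Qed.

Let uZ a x : u (phi a *: x) = a * u x.
Proof. by have := ul a x 0; rewrite u0 !addr0. Qed.

Lemma re_complexify x : re (complexify x) = u x.
Proof.
rewrite /complexify reD re_inR -mulrN -rmorphN re_im addr0//.
Qed.

Lemma complexify_linear : linear (complexify : W -> K^o).
Proof.
have cD x y : complexify (x + y) = complexify x + complexify y.
  by rewrite /complexify scalerDr !uD !rmorphD mulrDr opprD addrACA.
have cZ a x : complexify (phi a *: x) = phi a * complexify x.
  by rewrite /complexify scalerA (mulrC j (phi a)) -scalerA !uZ !rmorphM mulrBr (mulrCA j).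
have cj x : complexify (j *: x) = j * complexify x.
  rewrite /complexify; have [->|jj] := im_unit_sqr s.
    by rewrite !scale0r u0 rmorph0 !mul0r subr0.
  rewrite scalerA mulrBr mulrA jj scaleN1r.
  have -> : u (- x) = - u x by rewrite -scaleN1r -(rmorph1 phi) -rmorphN uZ mulN1r.
  by rewrite rmorphN mulrN mulN1r !opprK addrC.
move=> a x y; rewrite cD; congr (_ + _); rewrite {1}(scalarE s a).
rewrite scalerBl -scaleN1r -scalerA -(rmorph1 phi) -rmorphN cD !cZ cj cZ.
by rewrite rmorphN rmorph1 mulN1r mulrA -mulrBl -scalarE.
Qed.

End complexify.

Section seminorm_extension.
Context (W : lmodType K) (q : W -> R).
Hypothesis qD : forall x y, q (x + y) <= q x + q y.
Hypothesis qZ : forall a x, q (a *: x) = nrm a * q x.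

Lemma nrm_complexify_le (u : W -> R) :
  (forall a x y, u (phi a *: x + y) = a * u x + u y) ->
  (forall x, `|u x| <= q x) -> forall x, nrm (complexify u x) <= q x.
Proof.
move=> ul uq x; have [v v1 <-] := phase (complexify u x).
rewrite -[v * _]/(v *: (complexify u x : K^o)).
have fZ : complexify u (v *: x) = v * complexify u x.
  have f0 : complexify u 0 = 0.
    have := complexify_linear ul 1 0 0; rewrite !scale1r addr0 => h.
    by apply: (addrI (complexify u 0)); rewrite addr0.
  by have := complexify_linear ul v x 0; rewrite f0 !addr0.
rewrite /= -[v *: _]fZ re_complexify// (le_trans (ler_norm _))//.
by rewrite (le_trans (uq _))// qZ v1 mul1r.
Qed.

Theorem hahn_banach_scalars z : exists f : W -> K,
  [/\ linear (f : W -> K^o), forall x, nrm (f x) <= q x & re (f z) = q z].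
Proof.
have [|u [ul uq uz]] := @hahn_banach R (restrict_scalars phi W) q qD _ z.
  by move=> a x; rewrite restrict_scalarsE qZ nrm_inR.
exists (complexify (W := W) u); split.
- by apply: complexify_linear => a x y; exact: (ul a x y).
- by apply: nrm_complexify_le => // a x y; exact: (ul a x y).
- by rewrite re_complexify// => a x y; exact: (ul a x y).
Qed.

End seminorm_extension.

(** * Gauges and separation from absorbent sets *)

Section gauge.
Context (W : lmodType K) (A : set W).
Hypothesis Ac : absolutely_convex A.
Hypothesis Aa : absorbent A.

Definition gauge_set (x : W) : set R := [set r | 0 < r /\ A (phi r^-1 *: x)].
Definition gauge x := inf (gauge_set x).

Let gauge_set_has_inf x : has_inf (gauge_set x).
Proof.
split; last by exists 0 => r [/ltW].
have [_ /gt0_inR[r r0 ->] /(_ (phi r))] := Aa x.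
rewrite ger0_norm ?(ltW (etrans (inR_gt0 _) r0))// lexx => /(_ isT x erefl)[y Ay yx].
exists r; split => //; rewrite -yx scalerA -rmorphM mulVf ?gt_eqF//.
by rewrite rmorph1 scale1r.
Qed.

Lemma gauge_ge0 x : 0 <= gauge x.
Proof. by apply: lb_le_inf; [have [] := gauge_set_has_inf x|move=> r [/ltW]]. Qed.

Lemma gauge_le x r : 0 < r -> A (phi r^-1 *: x) -> gauge x <= r.
Proof. by move=> r0 Ar; apply: ge_inf; [have [] := gauge_set_has_inf x|split]. Qed.

Lemma gauge_lt x r : gauge x < r -> 0 < r /\ A (phi r^-1 *: x).
Proof.
move=> xr; have [t [t0 At] tr] := inf_lt (gauge_set_has_inf x).1 xr.
have r0 : 0 < r := lt_trans t0 tr; split => //.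
have -> : phi r^-1 *: x = phi (t / r) *: (phi t^-1 *: x).
  by rewrite scalerA -rmorphM mulrAC divff ?mul1r// gt_eqF.
apply: absolutely_convexZ => //; rewrite normr_le1 nrm_inR ger0_norm ?divr_ge0 ?(ltW t0) ?(ltW r0)//.
by rewrite ler_pdivrMr// mul1r ltW.
Qed.

Lemma gauge_le1 x : A x -> gauge x <= 1.
Proof. by move=> Ax; apply: gauge_le => //; rewrite invr1 rmorph1 scale1r. Qed.

Lemma gauge_lt1 x : gauge x < 1 -> A x.
Proof. by move=> /gauge_lt[_]; rewrite invr1 rmorph1 scale1r. Qed.

Lemma gaugeD x y : gauge (x + y) <= gauge x + gauge y.
Proof.
apply/ler_addgt0Pr => e e0; have e20 : 0 < e / 2 by rewrite divr_gt0.
have [r0 Ar] : 0 < gauge x + e / 2 /\ A (phi (gauge x + e / 2)^-1 *: x).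
  by apply: gauge_lt; rewrite ltrDl.
have [t0 At] : 0 < gauge y + e / 2 /\ A (phi (gauge y + e / 2)^-1 *: y).
  by apply: gauge_lt; rewrite ltrDl.
have -> : gauge x + gauge y + e = (gauge x + e / 2) + (gauge y + e / 2).
  by rewrite addrACA -splitr.
move: (gauge x + _) (gauge y + _) => r t in r0 Ar t0 At *.
have rt0 : 0 < r + t by exact: addr_gt0.
apply: gauge_le => //.
have -> : phi (r + t)^-1 *: (x + y) =
    phi (r / (r + t)) *: (phi r^-1 *: x) + phi (t / (r + t)) *: (phi t^-1 *: y).
  rewrite !scalerA -!rmorphM -!(mulrAC _ _^-1 (_ + _)^-1) !divff ?gt_eqF// !mul1r.
  exact: scalerDr.
apply: Ac => //; rewrite !(nrmE s) !nrm_inR -rmorphD -(rmorph1 phi) inR_le.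
rewrite !ger0_norm ?divr_ge0 ?(ltW r0) ?(ltW t0) ?(ltW rt0)//.
by rewrite -mulrDl divff// gt_eqF.
Qed.

Lemma gaugeZ a x : gauge (a *: x) = nrm a * gauge x.
Proof.
have A0 : A 0.
  have [_ /gt0_inR[r r0 ->] /(_ (phi r))] := Aa 0.
  rewrite ger0_norm ?(ltW (etrans (inR_gt0 _) r0))// lexx => /(_ isT 0 erefl)[y Ay yx].
  exact: (absolutely_convex0 Ac Ay).
have le b y : gauge (b *: y) <= nrm b * gauge y.
  have [->|b0] := eqVneq b 0.
    rewrite scale0r nrm0 mul0r; apply/ler_addgt0Pr => e e0; rewrite add0r.
    by apply: gauge_le => //; rewrite scaler0.
  have nb0 : 0 < nrm b by rewrite nrm_gt0.
  rewrite -ler_pdivrMl//; apply/ler_addgt0Pr => e e0; rewrite ler_pdivrMl//.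
  have [r0 Ar] : 0 < gauge y + e /\ A (phi (gauge y + e)^-1 *: y).
    by apply: gauge_lt; rewrite ltrDl.
  apply: gauge_le; first exact: mulr_gt0.
  rewrite scalerA invfM rmorphM -(mulrC b) mulrA -scalerA.
  apply: absolutely_convexZ => //; rewrite normr_le1 nrmM nrm_inR ger0_norm ?invr_ge0 ?nrm_ge0//.
  by rewrite divff// gt_eqF.
apply/eqP; rewrite eq_le le /=; have [->|a0] := eqVneq a 0.
  by rewrite nrm0 mul0r gauge_ge0.
have := le a^-1 (a *: x); rewrite scalerA mulVf// scale1r nrmV.
by rewrite -ler_pdivrMl ?invr_gt0 ?nrm_gt0// invrK.
Qed.

Lemma absolutely_convex_separation z : ~ A z -> exists f : W -> K,
  [/\ linear (f : W -> K^o), forall x, nrm (f x) <= gauge x,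
      forall x, A x -> nrm (f x) <= 1 & 1 <= re (f z)].
Proof.
move=> nAz; have [f [fl fq fz]] := hahn_banach_scalars gaugeD gaugeZ z.
exists f; split=> // [x Ax|]; first by rewrite (le_trans (fq x))// gauge_le1.
by rewrite fz leNgt; apply/negP => /gauge_lt1.
Qed.

End gauge.
End scalars_theory.

(** * Neighborhoods of zero and barrels *)

Section zero_neighborhoods.
Context (K : numFieldType) (E : tvsType K).
Implicit Types (U V A : set E) (x y z : E).

Lemma nbhs0_scale (c : K) U : nbhs (0 : E) U -> nbhs (0 : E) [set x | U (c *: x)].
Proof.
move=> U0; have /= := @scale_continuous _ E (c, 0) U.
rewrite scaler0 => /(_ U0)[[P Q] [/= Pc Q0] PQ].
by apply: filterS Q0 => x Qx; apply: (PQ (c, x)); split=> //=; exact: nbhs_singleton Pc.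
Qed.

Lemma nbhs0_half U : nbhs (0 : E) U ->
  exists2 V, nbhs (0 : E) V & forall x y, V x -> V y -> U (x + y).
Proof.
move=> U0; have /= := @add_continuous E (0, 0) U.
rewrite addr0 => /(_ U0)[[P Q] [/= P0 Q0] PQ].
exists (P `&` Q); first exact: filterI.
by move=> x y [Px _] [_ Qy]; exact: (PQ (x, y)).
Qed.

Lemma nbhs_translate x y A : nbhs (x + y) A -> nbhs y [set z | A (x + z)].
Proof.
move=> Axy; have /= := @add_continuous E (x, y) A Axy.
move=> [[P Q] [/= Px Qy] PQ].
by apply: filterS Qy => z Qz; apply: (PQ (x, z)); split=> //=; exact: nbhs_singleton Px.
Qed.

Lemma nbhs_shift0 x A : nbhs x A <-> nbhs (0 : E) [set z | A (x + z)].
Proof.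
split=> [xA|A0]; first by apply: nbhs_translate; rewrite addr0.
have : nbhs (- x + x) [set z | A (x + z)] by rewrite addNr.
by move/nbhs_translate; apply: filterS => z /=; rewrite addrA subrr add0r.
Qed.

Lemma nbhs0_absorbs_scale U : nbhs (0 : E) U -> exists2 e : K, 0 < e &
  exists2 V, nbhs (0 : E) V & forall t x, `|t| < e -> V x -> U (t *: x).
Proof.
move=> U0; have /= := @scale_continuous _ E (0, 0) U.
rewrite scaler0 => /(_ U0)[[P Q] [/= P0 Q0] PQ].
move: P0 => /nbhs_ballP[e /= e0 eP]; exists e => //; exists Q => // t x te Qx.
by apply: (PQ (t, x)); split => //; apply: eP; rewrite -ball_normE /= sub0r normrN.
Qed.

Lemma nbhs0_absorbent U : nbhs (0 : E) U -> absorbent U.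
Proof. by move=> U0 x; exact: tvs_bounded1. Qed.

Lemma absolutely_convex_closure (D : set E) :
  absolutely_convex D -> absolutely_convex (closure D).
Proof.
move=> Dc a b x y clx cly ab N /nbhs_shift0/nbhs0_half[V V0 VN].
have [x' [Dx' Vx']] : D `&` [set z | V (a *: (z - x))] !=set0.
  apply: clx; apply/nbhs_shift0; apply: filterS (nbhs0_scale a V0) => z /=.
  by rewrite addrAC subrr add0r.
have [y' [Dy' Vy']] : D `&` [set z | V (b *: (z - y))] !=set0.
  apply: cly; apply/nbhs_shift0; apply: filterS (nbhs0_scale b V0) => z /=.
  by rewrite addrAC subrr add0r.
exists (a *: x' + b *: y'); split; first exact: Dc.
have /= := VN _ _ Vx' Vy'; rewrite addrACA -!scalerDr.
by rewrite !(addrC _ (_ - _)) !subrK.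
Qed.

(** The balanced core [D] of a convex neighborhood [C] is absolutely convex, and its closure lies in
    [D + D], hence in [W + W] and in [U]. *)
Lemma nbhs0_absolutely_convex U : nbhs (0 : E) U ->
  exists V, [/\ nbhs (0 : E) V, closed V, absolutely_convex V & V `<=` U].
Proof.
move=> /nbhs0_half[W W0 WU].
have [C [C0 CW Cc]] : exists C, [/\ nbhs (0 : E) C, C `<=` W &
    forall (l : K) x y, 0 <= l -> l <= 1 -> C x -> C y -> C (l *: x + (1 - l) *: y)].
  have [B Bc [Bo /(_ 0 W W0)[C [BC C0] CW]]] := @locally_convex _ E.
  exists C; split=> //; first exact/open_nbhs_nbhs/(conj (Bo _ BC)).
  move=> l x y l0 l1 Cx Cy.
  have /(_ x y (Itv01 l0 l1)) := Bc C (mem_set BC).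
  by rewrite !inE; apply.
pose D := [set x | forall t : K, `|t| <= 1 -> C (t *: x)].
have D0 : nbhs (0 : E) D.
  have [e e0 [Q Q0 QC]] := nbhs0_absorbs_scale C0.
  apply: filterS (nbhs0_scale (e / 2)^-1 Q0) => x /= Qx t t1.
  have e2 : 0 < e / 2 by rewrite divr_gt0.
  rewrite -[x]scale1r -(divff (lt0r_neq0 e2)) -scalerA scalerA; apply: QC => //.
  rewrite normrM (gtr0_norm e2) (le_lt_trans (ler_piMl (ltW e2) t1))//.
  by rewrite ltr_pdivrMr// ltr_pMr// ltr1n.
have Dc : absolutely_convex D.
  move=> a b x y Dx Dy ab t t1.
  have CZ c z : D z -> `|c| <= 1 -> C (c *: z) by move=> + c1; apply.
  have [ab0|ab0] := eqVneq (`|a| + `|b|) 0.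
    have /andP[/eqP a0 /eqP b0] : (a == 0) && (b == 0).
      by rewrite -(normr_eq0 a) -(normr_eq0 b) -paddr_eq0// ab0.
    by rewrite a0 b0 !scale0r addr0 scaler0; exact: nbhs_singleton C0.
  have abp : 0 < `|a| + `|b| by rewrite lt_def ab0 addr_ge0.
  (* With weights proportional to [|a|] and [|b|], the vector [t *: (a *: x + b *: y)] is a convex
     combination of multiples of [x] and [y] by scalars of modulus at most one. *)
  pose l := `|a| / (`|a| + `|b|).
  have l1E : 1 - l = `|b| / (`|a| + `|b|).
    by apply/eqP; rewrite subr_eq -mulrDl addrC divff.
  have key c m : 0 <= m -> m = `|c| / (`|a| + `|b|) ->
      t * c = m * (t * c / m) /\ `|t * c / m| <= 1.
    move=> m0 mE; have [c0|c0] := eqVneq c 0.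
      by rewrite c0 !mulr0 mul0r mulr0 normr0.
    have m0' : m != 0 by rewrite mE mulf_neq0// ?normr_eq0// invr_eq0.
    rewrite (mulrC m) divfK//; split=> //.
    rewrite normrM normfV normrM mE (ger0_norm (divr_ge0 _ (ltW abp)))// invf_div.
    rewrite -mulrA [`|c| * _]mulrC divfK ?normr_eq0//.
    by rewrite mulr_ile1// ltW.
  have l0 : 0 <= l by rewrite divr_ge0// ltW.
  have l1 : l <= 1 by rewrite ler_pdivrMr// mul1r lerDl.
  have [aE a1] := key a l l0 erefl.
  have [bE b1] : t * b = (1 - l) * (t * b / (1 - l)) /\ `|t * b / (1 - l)| <= 1.
    by apply: key => //; rewrite subr_ge0.
  rewrite scalerDr !scalerA aE bE -(scalerA l) -(scalerA (1 - l)); apply: Cc => //; exact: CZ.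
exists (closure D); split.
- by apply: filterS D0; exact: subset_closure.
- exact: closed_closure.
- exact: absolutely_convex_closure.
- move=> x clx.
  have [y [Dy Dyx]] : D `&` [set y | D (y - x)] !=set0.
    apply: clx; apply/nbhs_shift0; apply: filterS D0 => z /=.
    by rewrite addrAC subrr add0r.
  have DC z : D z -> C z by move=> Dz; have := Dz 1; rewrite normr1 scale1r; exact.
  have Dxy : D (x - y) by rewrite -opprB; exact: (absolutely_convexN Dc).
  by have := WU _ _ (CW _ (DC _ Dy)) (CW _ (DC _ Dxy)); rewrite addrC subrK.
Qed.

End zero_neighborhoods.

Section barrels.
Context (K : numFieldType) (E : tvsType K).

Lemma linear_bounded_dual (f : E -> K^o) (U : set E) : linear f ->
  nbhs (0 : E) U -> (forall x, U x -> `|f x| <= 1) ->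
  exists g : tdual E, g = f :> (E -> K^o).
Proof.
move=> fl U0 fU.
suff fc : continuous f by exists (TDual (mem_set (conj fl fc) : f \in @dual_pred _ E)).
move=> x A /nbhs_ballP[e /= e0 eA]; suff : nbhs x (f @^-1` A) by [].
apply/nbhs_shift0.
have e2 : 0 < e / 2 by rewrite divr_gt0.
apply: filterS (nbhs0_scale (e / 2)^-1 U0) => z /= /fU fz.
apply: eA; rewrite -ball_normE /=.
have f0 : f 0 = 0.
  by have := fl 1 0 0; rewrite !scale1r addr0 => h; apply: (addrI (f 0)); rewrite addr0.
have -> : f x - f (x + z) = - f z.
  have := fl 1 x z; rewrite !scale1r => ->; by rewrite opprD addrA subrr add0r.
have fZ : f ((e / 2)^-1 *: z) = (e / 2)^-1 * f z.
  by have := fl (e / 2)^-1 z 0; rewrite f0 !addr0.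
move: fz; rewrite fZ normrN normrM gtr0_norm ?invr_gt0// ler_pdivrMl// mulr1.
by move=> /le_lt_trans; apply; rewrite ltr_pdivrMr// ltr_pMr// ltr1n.
Qed.

Lemma dualN (f : tdual E) x : f (- x) = - f x.
Proof. by rewrite -scaleN1r dualZ mulN1r. Qed.

Lemma dualB (f : tdual E) x y : f (x - y) = f x - f y.
Proof. by rewrite dualD dualN. Qed.

Lemma barrel_nbhs0_closed (V : set E) :
  nbhs (0 : E) V -> closed V -> absolutely_convex V -> barrel V.
Proof. by move=> V0 Vcl Vc; split => //; exact: nbhs0_absorbent. Qed.

Lemma barrel_bounded_tvs_bounded (B : set E) : barrel_bounded B -> tvs_bounded B.
Proof.
move=> bB U /nbhs0_absolutely_convex[V [V0 Vcl Vc VU]].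
have [n nB] := bB V (barrel_nbhs0_closed V0 Vcl Vc).
exists n.+1%:R => // t nt x /nB[v Vv <-].
have t0 : 0 < `|t| by exact: lt_le_trans nt.
exists ((n%:R / t) *: v); last by rewrite scalerA mulrC divfK// -normr_gt0.
apply: VU; apply: (absolutely_convexZ Vc) => //.
rewrite normrM normfV normr_nat ler_pdivrMr// mul1r (le_trans _ nt)// ler_nat//.
Qed.

End barrels.

(** * Separation from closed absolutely convex sets *)

Section separation.
Context (R : realType) (K : numFieldType) (s : scalars R K) (E : tvsType K).

(** Since [C] may fail to be absorbent, it is enlarged to [C + V] with [V] a small neighborhood of
    zero. Separating [t z] with [t < 1] instead of [z] makes the inequality at [z] strict. *)
Lemma closed_separation (C : set E) (z : E) : closed C -> absolutely_convex C ->
  C 0 -> ~ C z -> exists f : tdual E, polar C f /\ 1 < nrm s (f z).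
Proof.
move=> Ccl Cc C0 nCz.
have nCz_nbhs : nbhs z (~` C).
  by apply: open_nbhs_nbhs; split => //; rewrite openC.
have [t [t0 t1 nCtz]] : exists t : R, [/\ 0 < t, t < 1 & ~ C (inR s t *: z)].
  have := @scale_continuous _ E (1, z) (~` C); rewrite /= scale1r => /(_ nCz_nbhs).
  move=> [[P Q] [/= /nbhs_ballP[e /= e0 eP] Qz] PQ].
  have [r r0 er] := gt0_inR s e0.
  pose d := Num.min (r / 2) (2^-1).
  have d0 : 0 < d by rewrite lt_min divr_gt0//= invr_gt0.
  have dr : d < r.
    by rewrite gt_min; apply/orP; left; rewrite ltr_pdivrMr// ltr_pMr// ltr1n.
  have d1 : d < 1.
    by rewrite gt_min; apply/orP; right; rewrite invf_lt1// ltr1n.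
  exists (1 - d); split; [by rewrite subr_gt0|by rewrite gtrBl|].
  apply: (PQ (inR s (1 - d), z)); split; last exact: nbhs_singleton Qz.
  apply: eP; rewrite -ball_normE /= rmorphB rmorph1 opprB addrCA subrr addr0.
  by rewrite (nrmE s) nrm_inR gtr0_norm// er inR_lt.
have : nbhs (inR s t *: z) (~` C).
  by apply: open_nbhs_nbhs; split => //; rewrite openC.
move=> /nbhs_shift0/nbhs0_absolutely_convex[V [V0 Vcl Vc VC]].
pose A := [set c + v | c in C & v in V].
have CA : C `<=` A.
  by move=> c Cc'; exists c => //; exists 0; [exact: nbhs_singleton V0|rewrite addr0].
have VA : V `<=` A by move=> v Vv; exists 0 => //; exists v => //; rewrite add0r.
have Ac : absolutely_convex A.
  move=> a b _ _ [c Cc1 [v Vv <-]] [c' Cc2 [v' Vv' <-]] ab.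
  exists (a *: c + b *: c'); first exact: Cc.
  exists (a *: v + b *: v'); first exact: Vc.
  by rewrite !scalerDr addrACA.
have Aa : absorbent A by apply: nbhs0_absorbent; exact: filterS V0.
have nA : ~ A (inR s t *: z).
  move=> [c Cc' [v Vv cv]]; apply: (VC (- v)); first exact: (absolutely_convexN Vc).
  by rewrite /= -cv addrK.
have [f [fl _ fA fz]] := absolutely_convex_separation s Ac Aa nA.
have [|g gf] := linear_bounded_dual fl V0.
  by move=> x /VA/fA; rewrite (normr_le1 s).
exists g; split=> [x /CA/fA|]; first by rewrite gf (normr_le1 s).
have : 1 <= nrm s (g (inR s t *: z)).
  by rewrite gf (le_trans fz)// (le_trans (ler_norm _))// re_le_nrm.
rewrite dualZ nrmM nrm_inR gtr0_norm// -ler_pdivrMl// mulr1.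
by apply: lt_le_trans; rewrite invf_gt1.
Qed.

End separation.

(** * Barrels in Fréchet spaces *)

Section frechet.
Context (R : realType) (K : numFieldType) (s : scalars R K) (E : tvsType K).
Hypothesis E_frechet : frechet E R.

Lemma nat_ge (r : K) : 0 < r -> exists n : nat, r <= n.+1%:R.
Proof.
move=> /(gt0_inR s)[t t0 ->]; exists (Num.bound t); rewrite -(inR_nat s) inR_le.
by rewrite (le_trans (ltW (archi_boundP (ltW t0))))// ler_nat.
Qed.

(** Metric balls need not be absolutely convex; they only force the recursively chosen neighborhoods
    to shrink, and the halving condition replaces the triangle inequality. *)
Lemma nbhs0_sequence : exists U : nat -> set E,
  [/\ forall n, nbhs (0 : E) (U n), forall n, closed (U n),
      forall n, absolutely_convex (U n),
      forall n x y, U n.+1 x -> U n.+1 y -> U n (x + y) &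
      forall N, nbhs (0 : E) N -> exists n, U n `<=` N].
Proof.
have [[d dm dn] _] := E_frechet.
pose ball n := [set y : E | d 0 y < n.+1%:R^-1].
have ball0 n : nbhs (0 : E) (ball n) by apply/dn; exists n.+1%:R^-1.
have /choice[next nextP] (nV : nat * set E) : exists V, nbhs (0 : E) nV.2 ->
    [/\ nbhs (0 : E) V, closed V, absolutely_convex V,
        forall x y, V x -> V y -> nV.2 (x + y) & V `<=` ball nV.1].
  have [/nbhs0_half[W W0 WV]|nV0] := pselect (nbhs (0 : E) nV.2); last by exists setT.
  have [V [V0 Vcl Vc VW]] := nbhs0_absolutely_convex (filterI W0 (ball0 nV.1)).
  exists V => _; split=> //; last by move=> x /VW[].
  by move=> x y /VW[Wx _] /VW[Wy _]; exact: WV.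
pose F := fix F n := if n is n'.+1 then next (n', F n') else setT.
have F0 n : nbhs (0 : E) (F n).
  elim: n => [|n ih]; first exact: filterT.
  by have [] := nextP (n, F n) ih.
exists (fun n => F n.+1); split.
- by move=> n; exact: F0.
- by move=> n; have [] := nextP (n, F n) (F0 n).
- by move=> n; have [] := nextP (n, F n) (F0 n).
- by move=> n; have [] := nextP (n.+1, F n.+1) (F0 n.+1).
- move=> N /dn[e e0 eN]; have [n ne] := invS_le e0.
  exists n => x; have [_ _ _ _ Fb] := nextP (n, F n) (F0 n).
  by move=> /Fb bx; apply: eN; exact: lt_le_trans ne.
Qed.

(** If [T] is not a neighborhood of zero, its multiples contain no translate of any [U n].
    Completeness then gives a point outside all [n.+1%:R *: T], although [T] is absorbent. *)
Lemma barrel_nbhs0 (T : set E) : barrel T -> nbhs (0 : E) T.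
Proof.
move=> [Tcl Ta Tc]; apply: contrapT => nT.
have [U [U0 Ucl Uc UD Ubase]] := nbhs0_sequence.
have U00 n : U n 0 by exact: nbhs_singleton.
(* If [c T] contained [x + U n], then half the difference of [x + c y] and [x - c y], divided by
   [c], would put every small [y] into [T]. *)
have UT (c : K) x n : c != 0 -> ~ ([set x + u | u in U n] `<=` [set c *: v | v in T]).
  move=> c0 UcT; apply: nT.
  apply: filterS (filterI (nbhs0_scale c (U0 n)) (nbhs0_scale (- c) (U0 n))) => y /= [Uy Uny].
  have [v Tv xv] : [set c *: v | v in T] (x + c *: y).
    by apply: UcT; exists (c *: y).
  have [w Tw xw] : [set c *: v | v in T] (x + (- c) *: y).
    by apply: UcT; exists (- c *: y).
  have -> : y = 2^-1 *: v + (- 2^-1) *: w.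
    apply: (scalerI c0); rewrite scalerDr !scalerA mulrN mulrC scaleNr -!scalerA xv xw.
    rewrite -scalerBr opprD addrACA subrr add0r scaleNr opprK -scalerDl -mulr2n.
    by rewrite scalerA -(mulr_natl c) mulrA mulVf ?mul1r ?pnatr_eq0.
  apply: Tc => //; rewrite normrN ger0_norm ?invr_ge0//.
  by rewrite -[X in X + _]mul1r -[X in _ + X]mul1r -splitr.
have cTcl (c : K) : c != 0 -> closed [set c *: v | v in T].
  move=> c0; have -> : [set c *: v | v in T] = [set x | T (c^-1 *: x)].
    apply/seteqP; split=> [_ [v Tv <-] /=|x /= Tx]; first by rewrite scalerA mulVf// scale1r.
    by exists (c^-1 *: x) => //; rewrite scalerA divff// scale1r.
  apply: (@preimage_closed _ _ (fun x : E => c^-1 *: x)) => // x _ A.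
  move=> /(@scale_continuous _ E (c^-1, x))[[P Q] [/= Pc Qx] PQ].
  apply: filterS Qx => y Qy; apply: (PQ (c^-1, y)); split=> //=.
  exact: nbhs_singleton Pc.
have Umono m n : (m <= n)%N -> U n `<=` U m.
  elim: n => [|n ih]; first by rewrite leqn0 => /eqP ->.
  rewrite leq_eqVlt => /predU1P[->//|/ih nm] x Ux; apply: nm.
  by rewrite -[x]addr0; apply: UD => //; exact: U00.
(* Baire's argument: step n moves the centre by U (m_n + 1) out of (n + 1) T. *)
have /choice[next nextP] (c : nat * (E * nat)) : exists c' : E * nat,
    [/\ (c.2.2 < c'.2)%N, U c.2.2.+1 (c'.1 - c.2.1) &
        forall v, U c'.2 v -> ~ [set c.1.+1%:R *: v | v in T] (c'.1 + v)].
  case: c => n [x m] /=; have n0 : n.+1%:R != 0 :> K by rewrite pnatr_eq0.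
  have /existsNP[_ /not_implyP[[u Uu <-] nTxu]] := UT n.+1%:R x m.+1 n0.
  have : nbhs (x + u) (~` [set n.+1%:R *: v | v in T]).
    by apply: open_nbhs_nbhs; split => //; rewrite openC; exact: cTcl.
  move=> /nbhs_shift0/Ubase[p pT]; exists (x + u, maxn m.+1 p); split => /=.
  - by rewrite leq_max ltnSn.
  - by rewrite addrAC subrr add0r.
  - by move=> v Uv; apply: pT; apply: Umono Uv; exact: leq_maxr.
pose F := fix F n := if n is n'.+1 then next (n', F n') else (0 : E, 0%N).
have Fm n : (n <= (F n).2)%N.
  elim: n => // n ih; apply: (leq_ltn_trans ih).
  by have [] := nextP (n, F n).
have FU k n : U (F n).2 ((F (n + k)%N).1 - (F n).1).
  elim: k n => [|k ih] n; first by rewrite addn0 subrr.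
  have [mn Un _] := nextP (n, F n).
  have := UD _ _ _ (Umono _ _ mn _ (ih n.+1)) Un.
  by rewrite addSnnS addrA subrK.
have [x Fx] : exists x : E, (fun n => (F n).1) @ \oo --> x.
  apply: (E_frechet.2) => N /Ubase[p pN].
  exists [set (F n).1 | n in [set n | (p.+1 <= n)%N]].
    by exists p.+1 => // n /= pn; exists n.
  have FUp n : (p.+1 <= n)%N -> U p.+1 ((F n).1 - (F p.+1).1).
    move=> pn; have := FU (n - p.+1)%N p.+1; rewrite subnKC//; exact: (Umono _ _ (Fm p.+1)).
  move=> _ _ [n /= pn <-] [m /= pm <-]; apply: pN.
  have -> : (F n).1 - (F m).1 = ((F n).1 - (F p.+1).1) + - ((F m).1 - (F p.+1).1).
    by rewrite opprB addrA subrK.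
  by apply: UD; [exact: FUp|apply: (absolutely_convexN (Uc _)); exact: FUp].
(* The later centres stay in the closed set around the centre [(F n).1], hence so does their
   limit. *)
have xU n : U (F n).2 (x - (F n).1).
  apply: Ucl => N /nbhs_shift0 xN.
  have : nbhs x [set z | N (z - (F n).1)].
    by apply/nbhs_shift0; apply: filterS xN => z /=; rewrite addrAC.
  move=> /Fx[k _ kN]; exists ((F (n + k)%N).1 - (F n).1); split; first exact: FU.
  by apply: kN; rewrite /= leq_addl.
have [r r0 rT] := Ta x.
have [n nr] := nat_ge r0.
have [_ _ /(_ (x - (F n.+1).1))] := nextP (n, F n); apply; first exact: (xU n.+1).
rewrite addrC subrK; apply: rT => //.
by rewrite normr_nat.
Qed.

Lemma tvs_bounded_barrel_bounded (B : set E) : tvs_bounded B -> barrel_bounded B.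
Proof.
move=> bB U /[dup] /barrel_nbhs0 U0 [_ _ Uc]; have [r r0 rB] := bB U U0.
have [n nr] := nat_ge r0.
by exists n.+1; apply: rB; rewrite normr_nat.
Qed.

End frechet.

(** * Equicontinuous sequences of functionals *)

Section null_sequences.
Context (R : realType) (K : numFieldType) (s : scalars R K) (E : tvsType K).
Hypothesis E_frechet : frechet E R.
Local Notation phi := (inR s).

Definition weakstar_null (u : nat -> tdual E) := forall x (e : R), 0 < e ->
  exists N, forall n, (N <= n)%N -> nrm s (u n x) <= e.

(** This is the failure of the JNP, by [JNP_null_uniform]. The bound 1 loses nothing, since weak*
    null sequences can be rescaled. *)
Definition null_uniform := forall u, weakstar_null u -> forall B : set E,
  barrel_bounded B -> exists N, forall n, (N <= n)%N -> forall x, B x -> nrm s (u n x) <= 1.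

(** Real parts of functionals: the splitting argument compares real values, over either field. *)
Definition real_linear : set (E -> R) :=
  [set u | forall a x y, u (phi a *: x + y) = a * u x + u y].

Lemma real_linearB u x y : real_linear u -> u (x - y) = u x - u y.
Proof.
by move=> /(_ (-1) y x); rewrite rmorphN rmorph1 scaleN1r mulN1r addrC => ->; rewrite addrC.
Qed.

Lemma real_linear_mid u v : real_linear u -> real_linear v -> real_linear (mid u v).
Proof. by move=> ul vl a x y; rewrite /mid ul vl; ring. Qed.

Lemma real_linear_halfdiff u v :
  real_linear u -> real_linear v -> real_linear (fun x => (u x - v x) / 2).
Proof. by move=> ul vl a x y; rewrite ul vl; ring. Qed.

Lemma real_linear_sub u v :
  real_linear u -> real_linear v -> real_linear (fun x => u x - v x).
Proof. by move=> ul vl a x y; rewrite ul vl; ring. Qed.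

Lemma real_linear_lim (F : set_system nat) (u : nat -> E -> R) (v : E -> R) :
  ProperFilter F -> (forall n, real_linear (u n)) ->
  (forall x, u ^~ x @ F --> v x) -> real_linear v.
Proof.
move=> FF ul uv a x y; apply: (cvg_unique _ (uv _)) => //=.
under eq_fun do rewrite ul.
by apply: cvgD; [apply: cvgM; [exact: cvg_cst|exact: uv]|exact: uv].
Qed.

Lemma tvs_bounded_gauge (B V : set E) : nbhs (0 : E) V -> absolutely_convex V ->
  tvs_bounded B -> exists M, forall x, B x -> gauge s V x <= M.
Proof.
move=> V0 Vc /(_ V V0)[_ /(gt0_inR s)[r r0 ->] rB]; exists r => x Bx.
have [|v Vv <-] := rB (phi r) _ x Bx.
  by rewrite (nrmE s) nrm_inR gtr0_norm.
have Va := nbhs0_absorbent V0.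
by rewrite gaugeZ// nrm_inR gtr0_norm// ler_piMr ?(ltW r0)// gauge_le1.
Qed.

Lemma gauge_tvs_bounded (I : Type) (U : I -> set E) (B : set E) :
  (forall i, nbhs (0 : E) (U i)) -> (forall i, absolutely_convex (U i)) ->
  (forall N, nbhs (0 : E) N -> exists i, U i `<=` N) ->
  (forall i, exists M, forall x, B x -> gauge s (U i) x <= M) -> tvs_bounded B.
Proof.
move=> U0 Uc Ubase UM N /Ubase[i UN]; have [M BM] := UM i.
have M0 : 0 < `|M| + 1 by rewrite ltr_wpDl.
exists (phi (`|M| + 1)); first by rewrite inR_gt0.
move=> t Mt x Bx; have t0 : 0 < `|t| by apply: lt_le_trans Mt; rewrite inR_gt0.
exists (t^-1 *: x); last by rewrite scalerA divff ?scale1r// -normr_gt0.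
apply: UN; apply: (@gauge_lt1 _ _ s) => //; first exact: nbhs0_absorbent.
rewrite gaugeZ//; last exact: nbhs0_absorbent.
have nt0 : 0 < nrm s t by rewrite nrm_gt0 -normr_gt0.
rewrite nrmV ltr_pdivrMl// mulr1 (le_lt_trans (BM x Bx))//.
move: Mt; rewrite (nrmE s) inR_le; apply: lt_le_trans.
by rewrite ltr_pwDr// ler_norm.
Qed.

Hypothesis null_unif : null_uniform.

Lemma real_linear_null_uniform (V : set E) (g : nat -> E -> R) (B : set E) (e : R) :
  nbhs (0 : E) V -> absolutely_convex V -> (forall k, real_linear (g k)) ->
  (forall k x, `|g k x| <= 2 * gauge s V x) ->
  (forall x, g ^~ x @ \oo --> (0 : R)) -> tvs_bounded B -> 0 < e ->
  exists N, forall k, (N <= k)%N -> forall x, B x -> `|g k x| <= e.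
Proof.
move=> V0 Vc gl gV g0 bB e0; have Va := nbhs0_absorbent V0.
have fle k x : nrm s (complexify s (g k) x) <= 2 * gauge s V x.
  apply: (@nrm_complexify_le _ _ s _ (fun x => 2 * gauge s V x)); last exact: gV.
    by move=> a z; rewrite gaugeZ// mulrCA.
  exact: gl.
have fP : forall n, exists f : tdual E, f = complexify s (g n) :> (E -> K^o).
  move=> n.  apply: (linear_bounded_dual (complexify_linear (gl n)) (nbhs0_scale 2 V0)).
  move=> x /= Vx; rewrite (normr_le1 s) (le_trans (fle n x))//.
  have := gauge_le1 s Va Vx; rewrite gaugeZ//.
  by rewrite -(inR_nat s) nrm_inR ger0_norm.
have {fP}[f fE] := choice fP.
have f_null : weakstar_null (fun k => phi e^-1 *: f k).
  (* Bounding [g k] by this constant at both [x] and [im_unit s *: x] bounds the complexified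
     functional by [e * d] at [x]. *)
  move=> x d d0; have c0 : 0 < e * d / (1 + nrm s (im_unit s)).
    by rewrite divr_gt0 ?mulr_gt0// ltr_pwDl// nrm_ge0.
  have /cvgnP/(_ _ c0)[N1 gN1] := g0 x.
  have /cvgnP/(_ _ c0)[N2 gN2] := g0 (im_unit s *: x).
  exists (maxn N1 N2) => k; rewrite geq_max => /andP[N1k N2k].
  rewrite dualZE nrmM nrm_inR gtr0_norm ?invr_gt0// ler_pdivrMl// fE.
  rewrite /complexify (le_trans (nrmD _ _ _))// nrmN nrmM !nrm_inR.
  have := gN1 k N1k; have := gN2 k N2k; rewrite !sub0r !normrN => h2 h1.
  have j0 := nrm_ge0 s (im_unit s).
  rewrite (le_trans (lerD h1 (ler_wpM2l j0 h2)))//.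
  rewrite -[X in X + _]mul1r -mulrDl mulrC divfK// gt_eqF// ltr_pwDl//.
have [N fN] := null_unif f_null (tvs_bounded_barrel_bounded s E_frechet bB).
exists N => k Nk x Bx; have := fN k Nk x Bx.
rewrite dualZE nrmM nrm_inR gtr0_norm ?invr_gt0// ler_pdivrMl// mulr1 fE.
by apply: le_trans; rewrite -[g k x](re_complexify s (g k)) re_le_nrm.
Qed.

Lemma equicontinuous_subsequence (V : set E) (f : nat -> E -> R) :
  nbhs (0 : E) V -> absolutely_convex V -> (forall k, real_linear (f k)) ->
  (forall k x, `|f k x| <= gauge s V x) ->
  exists2 g, finer_sub g f & exists h : E -> R,
    forall (B : set E) (e : R), tvs_bounded B -> 0 < e ->
    exists N, forall k, (N <= k)%N -> forall x, B x -> `|g k x - h x| <= e.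
Proof.
move=> V0 Vc fl fV; have [U [U0 Ucl Uc UD Ubase]] := nbhs0_sequence E_frechet.
(* Index 0 is the dominating gauge; the others come from a base of neighborhoods, so that
   [seq_bounded] implies boundedness in [E]. *)
pose p n := gauge s (if n is n'.+1 then U n' else V).
have pbnd y : seq_bounded p y -> tvs_bounded (range y).
  move=> py; apply: (gauge_tvs_bounded U0 Uc Ubase) => n.
  by have [M yM] := py n.+1; exists M => _ [k _ <-]; exact: yM.
have [|g gf [h hl gh]] := subsequence_cvg (p := p) real_linear_mid
  real_linear_halfdiff real_linear_sub real_linear_lim _ fl fV.
  move=> g gl gp g0 y /pbnd yb; apply/cvgnP => e e0.
  have [N gN] := real_linear_null_uniform V0 Vc gl gp g0 yb e0.
  by exists N => k Nk; rewrite sub0r normrN; apply: gN.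
exists g => //; exists h => B e bB e0.
have /finer_subP gE := gf.
have gl k : real_linear (g k) by have [j _ ->] := gE k.
have gV k x : `|g k x| <= gauge s V x by have [j _ ->] := gE k.
apply: (@real_linear_null_uniform V (fun k x => g k x - h x)) => //.
- by move=> k; exact: real_linear_sub.
- move=> k x; rewrite (le_trans (ler_normB _ _))// mulr_natl mulr2n lerD//.
  by apply: (cvgr_to_le (cvg_norm (gh x))); exact: nearW.
- by move=> x; rewrite -[X in _ --> X](subrr (h x)); apply: cvgB => //; exact: cvg_cst.
Qed.

End null_sequences.

(** Along one ultrafilter all of these finitely many bounded sequences converge, so two indices in a
    common large set serve them simultaneously. *)
Lemma bounded_family_close (R : realType) (k : nat) (phi : nat -> nat -> R) (e : R) :
  (forall i, (i < k)%N -> exists M, forall n, `|phi i n| <= M) -> 0 < e ->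
  exists m n, (m < n)%N /\ forall i, (i < k)%N -> `|phi i n - phi i m| <= e.
Proof.
move=> phiM e0; have [U [UU Uoo]] := @ultraFilterLemma _ \oo _.
have UP : ProperFilter U by exact: ultra_proper.
have /choice[l lP] i : exists l : R, (i < k)%N -> U [set n | `|l - phi i n| <= e / 2].
  have [ik|_] := boolP (i < k)%N; last by exists 0.
  have [M iM] := phiM i ik; have [l /cvgrPdist_le il] := ultra_lim UU iM.
  by exists l => _; apply: il; rewrite divr_gt0.
have Uk j : (j <= k)%N -> U [set n | forall i, (i < j)%N -> `|l i - phi i n| <= e / 2].
  elim: j => [_|j ih jk]; first exact: filterE.
  apply: filterS (filterI (ih (ltnW jk)) (lP _ jk)) => n [/= h1 h2] i.
  by rewrite ltnS leq_eqVlt => /predU1P[->//|]; exact: h1.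
have [m mP] := filter_ex (Uk k (leqnn k)).
have Um : U [set n | (m < n)%N] by apply: Uoo; exists m.+1.
have [n [/= mn nP]] := filter_ex (filterI Um (Uk k (leqnn k))).
exists m, n; split => // i ik; have := mP i ik; have := nP i ik.
by rewrite !ler_norml => /andP[? ?] /andP[? ?]; apply/andP; split; lra.
Qed.

(** * Compactness of closed bounded sets *)

Section precompact.
Context (R : realType) (K : numFieldType) (s : scalars R K) (E : tvsType K).
Hypothesis E_frechet : frechet E R.
Hypothesis null_unif : null_uniform s E.

(** From a separated sequence, differences [z_n] and functionals [u_n] dominated by the gauge of [V]
    are built with [u_n z_n >= 1] and [|u_i z_n| <= 1/4] for [i < n]. No subsequence of the [u_n]
    converges uniformly on the bounded set [Z] of differences, contrary to
    [equicontinuous_subsequence]. *)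
Lemma bounded_no_separated (B V : set E) (y : nat -> E) : tvs_bounded B ->
  nbhs (0 : E) V -> absolutely_convex V -> (forall n, B (y n)) ->
  ~ (forall m n, (m < n)%N -> ~ V (y n - y m)).
Proof.
move=> bB V0 Vc By yV; have Va := nbhs0_absorbent V0.
pose good u := real_linear s u /\ forall x, `|u x| <= gauge s V x.
pose Z := [set z | exists m n, z = y n - y m].
have [M BM] := tvs_bounded_gauge s V0 Vc bB.
have bZ : tvs_bounded Z.
  have [U [U0 _ Uc _ Ubase]] := nbhs0_sequence E_frechet.
  apply: (gauge_tvs_bounded (s := s) U0 Uc Ubase) => i.
  have [N BN] := tvs_bounded_gauge s (U0 i) (Uc i) bB.
  exists (N + N) => _ [m [n ->]]; have Ua := nbhs0_absorbent (U0 i).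
  rewrite (le_trans (gaugeD s (Uc i) Ua _ _))// -[- y m]scaleN1r gaugeZ//.
  by rewrite nrmN nrm1 mul1r lerD// BN.
pose P (l : seq (E * (E -> R))) (zu : E * (E -> R)) :=
  (forall i, (i < size l)%N -> good (nth (0, fun=> 0) l i).2) ->
  [/\ good zu.2, Z zu.1, 1 <= zu.2 zu.1 &
      forall i, (i < size l)%N -> `|(nth (0, fun=> 0) l i).2 zu.1| <= 4^-1].
have [l|zu zuP] := @history_choice _ P.
  have [lg|nlg] := pselect
      (forall i, (i < size l)%N -> good (nth (0, fun=> 0) l i).2); last first.
    by exists (0, fun=> 0) => lg; case: (nlg lg).
  (* Two terms on which the earlier functionals nearly agree have a difference that those
     functionals nearly annihilate. *)
  have [||m [n [mn yl]]] := @bounded_family_close R (size l)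
      (fun i n => (nth (0, fun=> 0) l i).2 (y n)) 4^-1 => //.
    move=> i il; exists M => n; have [_ gl] := lg i il.
    exact: le_trans (gl _) (BM _ (By n)).
  have [f [fl fV _ fz]] := absolutely_convex_separation s Vc Va (yV m n mn).
  exists (y n - y m, fun x => re s (f x)) => _; split => //=.
  - split=> [a x z|x]; last exact: le_trans (re_le_nrm s _) (fV x).
    by rewrite fl re_linear.
  - by exists m, n.
  - by move=> i il; have [ul _] := lg i il; rewrite (real_linearB _ _ ul); exact: yl.
have zug n : good (zu n).2.
  have : forall m, (m < n.+1)%N -> good (zu m).2; last exact.
  elim: (n.+1) => // {}n ih m; rewrite ltnS => mn.
  have [|//] := zuP m; rewrite size_mkseq => i im; rewrite nth_mkseq//.
  by apply: ih; exact: leq_trans mn.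
have {}zuP n : [/\ Z (zu n).1, 1 <= (zu n).2 (zu n).1 &
    forall i, (i < n)%N -> `|(zu i).2 (zu n).1| <= 4^-1].
  have [|_ Zn un ui] := zuP n.
    by rewrite size_mkseq => i im; rewrite nth_mkseq.
  split=> // i im; have := ui i; rewrite size_mkseq nth_mkseq//; exact.
have [g /finer_subP gE [h gh]] := equicontinuous_subsequence E_frechet null_unif V0 Vc
  (fun k => (zug k).1) (fun k => (zug k).2).
(* Two errors of 1/8 plus the bound 1/4 stay below 1. *)
have e8 : 0 < 8^-1 :> R by rewrite invr_gt0.
have [N gN] := gh Z 8^-1 bZ e8.
have [i Ni giE] := gE N; have [j jk gjE] := gE (maxn N i.+1).
have [Zj uj ui] := zuP j.
have ij : (i < j)%N by rewrite (leq_trans _ jk)// leq_maxr.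
have := gN N (leqnn N) _ Zj; have := gN _ (leq_maxl N i.+1) _ Zj; have := ui i ij.
rewrite giE gjE !ler_norml => /andP[? ?] /andP[? ?] /andP[? ?]; lra.
Qed.

(** An ultrafilter that is not Cauchy avoids every translate of some neighborhood [V], so a
    separated sequence can be picked from [B] term by term. *)
Lemma closed_bounded_compact (B : set E) : closed B -> tvs_bounded B -> compact B.
Proof.
move=> Bcl bB; rewrite compact_ultra => F FF FB.
have FP : ProperFilter F by exact: ultra_proper.
suff /(E_frechet.2)[x Fx] : tvs_cauchy F.
  exists x; split=> //; apply: Bcl => N /Fx FN.
  exact: filter_ex (filterI FB FN).
move=> U U0; apply: contrapT => nU.
have [W W0 WU] := nbhs0_half U0.
have [V [V0 Vcl Vc VW]] := nbhs0_absolutely_convex W0.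
have FV y : F (~` [set x | V (x - y)]).
  have [FV|//] := in_ultra_setVsetC [set x | V (x - y)] FF.
  exfalso; apply: nU; exists [set x | V (x - y)] => // x x' /= Vx Vx'.
  have -> : x - x' = (x - y) + - (x' - y) by rewrite opprB addrA subrK.
  by apply: WU; apply: VW => //; exact: absolutely_convexN.
have [l|y yP] := @history_choice _ (fun (l : seq E) y =>
    B y /\ forall i, (i < size l)%N -> ~ V (y - nth 0 l i)).
  suff : F (B `&` [set y | forall i, (i < size l)%N -> ~ V (y - nth 0 l i)]).
    by move=> /filter_ex[y]; exists y.
  apply: filterI => //; elim: (size l) => [|n ih]; first exact: filterE.
  apply: filterS (filterI ih (FV (nth 0 l n))) => y [/= h1 h2] i.
  by rewrite ltnS leq_eqVlt => /predU1P[->//|]; exact: h1.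
apply: (bounded_no_separated bB V0 Vc (fun n => (yP n).1)) => m n mn.
by have [_ /(_ m)] := yP n; rewrite size_mkseq nth_mkseq// => /(_ mn).
Qed.

End precompact.

(** * Montel spaces *)

Section polar_theory.
Context (K : numFieldType) (E : tvsType K).

Lemma closed_prepolar (F : set (tdual E)) : closed (prepolar F).
Proof.
move=> x clx f Ff; apply: (@dual_ball_closed _ _ f x).
by apply: closureS clx => y; exact.
Qed.

Lemma absolutely_convex_prepolar (F : set (tdual E)) : absolutely_convex (prepolar F).
Proof.
move=> a b x y Fx Fy ab f Ff; rewrite dualD !dualZ (le_trans (ler_normD _ _))//.
by rewrite !normrM (le_trans _ ab)// lerD// ler_piMr ?Fx ?Fy.
Qed.

Lemma tdual_sumE (I : Type) (r : seq I) (f : I -> tdual E) x :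
  (\sum_(i <- r) f i) x = \sum_(i <- r) f i x.
Proof. by rewrite (big_morph (fun g : tdual E => g x : K) (id1 := 0) (op1 := +%R)). Qed.

Lemma tvs_bounded_absorbs_closure (B V : set E) : closed V -> absolutely_convex V ->
  absorbs V B -> absorbs V (closure B).
Proof.
move=> Vcl Vc [r r0 rB]; exists r => // t rt x clx.
have t0 : t != 0 by rewrite -normr_gt0; exact: lt_le_trans rt.
exists (t^-1 *: x); last by rewrite scalerA divff// scale1r.
apply: Vcl => N /(@scale_continuous _ E (t^-1, x))[[P Q] [/= Pc Qx] PQ].
have [b [Bb Qb]] := clx Q Qx; exists (t^-1 *: b); split.
  by have [v Vv <-] := rB t rt b Bb; rewrite scalerA mulVf// scale1r.
by apply: (PQ (t^-1, b)); split => //; exact: nbhs_singleton Pc.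
Qed.

Lemma closure_tvs_bounded (B : set E) : tvs_bounded B -> tvs_bounded (closure B).
Proof.
move=> bB U /nbhs0_absolutely_convex[V [V0 Vcl Vc VU]].
have [r r0 rV] := tvs_bounded_absorbs_closure Vcl Vc (bB V V0).
by exists r => // t rt x /(rV t rt)[v /VU Uv <-]; exists v.
Qed.

End polar_theory.

Section montel_null_uniform.
Context (R : realType) (K : numFieldType) (s : scalars R K) (E : tvsType K).
Hypothesis E_frechet : frechet E R.

Lemma montel_null_uniform : montel E -> null_uniform s E.
Proof.
move=> [_ compactE] u u0 B /barrel_bounded_tvs_bounded bB.
pose T := prepolar (range u).
have T0 : nbhs (0 : E) T.
  apply: (barrel_nbhs0 s E_frechet); split.
  - exact: closed_prepolar.
  - move=> x; have [N uN] := u0 x 1 ltr01.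
    exists (1 + \sum_(n < N) `|u n x|); first by rewrite ltr_pwDl// sumr_ge0.
    move=> t xt _ ->.
    have t0 : 0 < `|t| by apply: lt_le_trans xt; rewrite ltr_pwDl// sumr_ge0.
    exists (t^-1 *: x); last by rewrite scalerA divff ?scale1r// -normr_gt0.
    move=> _ [n _ <-]; rewrite dualZ normrM normfV mulrC ler_pdivrMr// mul1r.
    apply: le_trans xt; have [nN|Nn] := ltnP n N.
      by rewrite (bigD1 (Ordinal nN))//= addrCA lerDl addr_ge0// sumr_ge0.
    by rewrite ler_wpDr ?sumr_ge0// (normr_le1 s) uN.
  - exact: absolutely_convex_prepolar.
apply: contrapT => /forallNP nN.
have /choice[c cP] N : exists nx : nat * E,
    [/\ (N <= nx.1)%N, B nx.2 & 1 < nrm s (u nx.1 nx.2)].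
  apply: contrapT => nnx; apply: (nN N) => n Nn x Bx; rewrite leNgt.
  by apply/negP => unx; apply: nnx; exists (n, x).
have := compactE (closure B) (@closed_closure _ _) (closure_tvs_bounded bB).
move=> /(_ ((fun N => (c N).2) @ \oo) _)[].
  exists 0%N => // N _ /=; apply: subset_closure; by have [] := cP N.
move=> y [_ ycl].
have h0 : 0 < 2^-1 :> R by rewrite invr_gt0.
have [N uN] := u0 y 2^-1 h0.
have [||x [[k /= Nk <-] /= Tx]] := ycl [set (c k).2 | k in [set k | (N <= k)%N]]
    [set x | T (2 *: (x - y))].
- by exists N => // k /= Nk; exists k.
- apply/nbhs_shift0; apply: filterS (nbhs0_scale 2 T0) => z /=.
  by rewrite addrAC subrr add0r.
have [kn _] := cP k; apply/negP; rewrite -leNgt -[(c k).2](subrK y) addrC dualD.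
(* Pointwise convergence at the cluster point [y] and equicontinuity on [(c k).2 - y] each
   contribute at most one half. *)
rewrite (le_trans (nrmD _ _ _))// [leRHS](splitr 1) lerD//.
  by rewrite mul1r uN// (leq_trans Nk).
have /(_ (ex_intro2 _ _ (c k).1 I erefl)) := Tx (u (c k).1).
by rewrite dualZ (normr_le1 s) nrmM -(inR_nat s) nrm_inR ger0_norm// -ler_pdivlMl// mulrC.
Qed.

End montel_null_uniform.

(** * Reflexivity from compactness of closed bounded sets *)

Section reflexivity.
Context (R : realType) (K : numFieldType) (s : scalars R K) (E : tvsType K).
Hypothesis E_hausdorff : hausdorff_space E.
Hypothesis E_frechet : frechet E R.
Hypothesis E_compact : forall B : set E, closed B -> tvs_bounded B -> compact B.

Lemma eval_bidual_linear : linear (@eval_bidual K E).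
Proof.
move=> a x y; apply: val_inj; apply/funext => f /=.
by rewrite dual_linearP.
Qed.

Lemma eval_bidualB (x y : E) : eval_bidual x - eval_bidual y = eval_bidual (x - y).
Proof.
have := eval_bidual_linear (-1) y x.
by rewrite !scaleN1r (addrC (- y)) => ->; exact: addrC.
Qed.

(** Strongly bounded sets of functionals are equicontinuous, because their prepolars are barrels. *)
Lemma eval_bidual_continuous : continuous (@eval_bidual K E).
Proof.
move=> x A /(nbhs_strong_dual (eval_bidual x : strong_dual (strong_dual E)) A)[B bB BA].
suff : nbhs x (@eval_bidual K E @^-1` A) by [].
apply/nbhs_shift0.
have T0 : nbhs (0 : E) (prepolar (B : set (tdual E))).
  apply: (barrel_nbhs0 s E_frechet); split.
  - exact: closed_prepolar.
  - move=> z; have [r r0 rB] : absorbs (polar [set z] : set (strong_dual E)) B.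
      apply: bB; apply/(nbhs_strong_dual (0 : strong_dual E)).
      by exists [set z]; [exact: tvs_bounded1|move=> g; rewrite subr0].
    exists r => // t rt _ ->.
    have t0 : 0 < `|t| by exact: lt_le_trans rt.
    exists (t^-1 *: z); last by rewrite scalerA divff ?scale1r// -normr_gt0.
    move=> f Bf; rewrite dualZ normrM normfV mulrC ler_pdivrMr// mul1r.
    have [g /= gz <-] := rB t rt f Bf.
    by rewrite dualZE normrM ler_piMr ?gz.
  - exact: absolutely_convex_prepolar.
apply: filterS T0 => z Tz; apply: BA; rewrite eval_bidualB addrAC subrr add0r.
exact: Tz.
Qed.

Lemma polar_strong_bounded (V : set E) : nbhs (0 : E) V ->
  tvs_bounded (polar V : set (strong_dual E)).
Proof.
move=> V0 N /(nbhs_strong_dual (0 : strong_dual E))[B bB BN].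
have [r r0 rB] := bB V V0; exists r => // t rt f Vf.
have t0 : 0 < `|t| by exact: lt_le_trans rt.
exists (t^-1 *: f); last by rewrite scalerA divff ?scale1r// -normr_gt0.
apply: BN => b Bb; rewrite subr0 dualZE.
have [v Vv <-] := rB t rt b Bb.
by rewrite dualZ mulrA mulVf -?normr_gt0// mul1r Vf.
Qed.

Lemma eval_bidual_sub_nbhs (V : set E) x y : nbhs (0 : E) V -> closed V ->
  absolutely_convex V ->
  polar (polar V : set (strong_dual E)) (eval_bidual x - eval_bidual y) -> V (x - y).
Proof.
move=> V0 Vcl Vc xy; apply: contrapT => nV.
have [f [Vf]] := closed_separation s Vcl Vc (nbhs_singleton V0) nV.
apply/negP; rewrite -leNgt -(normr_le1 s).
by move: xy; rewrite eval_bidualB; apply.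
Qed.

Lemma eval_bidual_inj : injective (@eval_bidual K E).
Proof.
move=> x y xy; apply/eqP; rewrite -subr_eq0; apply/eqP/esym/E_hausdorff.
move=> A B /nbhs0_absolutely_convex[V [V0 Vcl Vc VA]] /nbhs_singleton Bxy.
exists (x - y); split => //; apply: VA; apply: (eval_bidual_sub_nbhs V0 Vcl Vc).
by rewrite xy subrr => f _; rewrite normr0.
Qed.

(* Separation in [K^n], where [n] is the length of [l]. *)
Lemma finite_approximation (C : set E) (phi : tdual E -> K) (l : seq (tdual E)) :
  absolutely_convex C -> C 0 ->
  (forall a f g, phi (a *: f + g) = a * phi f + phi g) ->
  (forall f, polar C f -> nrm s (phi f) < 1) ->
  exists2 x, C x & forall i, (i < size l)%N -> nrm s (nth 0 l i x - phi (nth 0 l i)) <= 1.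
Proof.
move=> Cc C0 phil Cphi; apply: contrapT => nx; pose n := size l.
have phi0 : phi 0 = 0.
  by have := phil 1 0 0; rewrite scale1r addr0 mul1r => h; apply: (addrI (phi 0)); rewrite addr0.
pose A : set 'rV[K]_n := [set v | exists2 x, C x &
  forall i : 'I_n, nrm s (nth 0 l i x - v 0 i) <= 1].
have Ac : absolutely_convex A.
  move=> a b v w [x Cx vx] [y Cy wy] ab; exists (a *: x + b *: y); first exact: Cc.
  move=> i; rewrite !mxE dualD !dualZ opprD addrACA -!mulrBr.
  rewrite (le_trans (nrmD _ _ _))// !nrmM.
  move: ab; rewrite !(nrmE s) -rmorphD -(rmorph1 (inR s)) inR_le; apply: le_trans.
  by rewrite lerD// ler_piMr ?nrm_ge0 ?vx ?wy.
have Aa : absorbent A.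
  move=> v; exists (1 + \sum_i `|v 0 i|); first by rewrite ltr_pwDl// sumr_ge0.
  move=> t vt _ ->; have t0 : 0 < `|t| by apply: lt_le_trans vt; rewrite ltr_pwDl// sumr_ge0.
  exists (t^-1 *: v); last by rewrite scalerA divff ?scale1r// -normr_gt0.
  exists 0 => // i; rewrite dual0 sub0r nrmN mxE -(normr_le1 s) normrM normfV.
  rewrite mulrC ler_pdivrMr// mul1r (le_trans _ vt)// (bigD1 i)//= addrCA lerDl.
  by rewrite addr_ge0// sumr_ge0.
have [|G [Gl _ GA Gv]] := @absolutely_convex_separation _ _ s _ A Ac Aa
    (\row_i phi (nth 0 l i)).
  move=> [x Cx xl]; apply: nx; exists x => // i il.
  by have := xl (Ordinal il); rewrite mxE.
have G0 : G 0 = 0.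
  by have := Gl 1 0 0; rewrite !scale1r addr0 => h; apply: (addrI (G 0)); rewrite addr0.
have GD : {morph G : u v / u + v} by move=> u v; have := Gl 1 u v; rewrite !scale1r.
have GE v : G v = \sum_i v 0 i * G (delta_mx 0 i).
  rewrite {1}[v]row_sum_delta (big_morph G GD G0); apply: eq_bigr => i _.
  by have := Gl (v 0 i) (delta_mx 0 i) 0; rewrite G0 !addr0.
pose f := \sum_(i < n) G (delta_mx 0 i) *: nth 0 l i.
have phiD : {morph phi : g h / g + h} by move=> g h; have := phil 1 g h; rewrite scale1r mul1r.
have phif : phi f = G (\row_i phi (nth 0 l i)).
  rewrite GE (big_morph phi phiD phi0); apply: eq_bigr => i _; rewrite mxE mulrC.
  by have := phil (G (delta_mx 0 i)) (nth 0 l i) 0; rewrite phi0 !addr0.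
have fC : polar C f.
  move=> x Cx; have -> : f x = G (\row_i nth 0 l i x).
    by rewrite tdual_sumE GE; apply: eq_bigr => i _; rewrite mxE mulrC.
  rewrite (normr_le1 s); apply: GA; exists x => // i.
  by rewrite mxE subrr nrm0.
have := Cphi f fC; rewrite phif; apply/negP; rewrite -leNgt.
by rewrite (le_trans Gv)// (le_trans (ler_norm _))// re_le_nrm.
Qed.

(** The functional [phi] is bounded by 1 on the polar of a bounded set [B]. Points of the compact
    set [C], twice the bipolar of [B], approximate [phi] on each finite list, and a cluster point of
    these approximations represents [phi]. The factor 2 provides the strict bound required by
    [finite_approximation]. *)
Lemma eval_bidual_surj (phi : strong_dual (strong_dual E)) :
  exists x, eval_bidual x = phi.
Proof.
have [B bB Bphi] := (nbhs_strong_dual (0 : strong_dual E) _).1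
  (dual_ball_nbhs (phi : tdual (strong_dual E))).
pose C := prepolar [set 2^-1 *: f | f in polar B].
have Ccl : closed C by exact: closed_prepolar.
have Cc : absolutely_convex C by exact: absolutely_convex_prepolar.
have C0 : C 0 by move=> f _; rewrite dual0 normr0.
have CB x : B x -> C (2 *: x).
  move=> Bx _ [f Bf <-]; rewrite dualZE dualZ mulrA mulVf ?pnatr_eq0// mul1r.
  exact: Bf.
have bC : tvs_bounded C.
  move=> U /nbhs0_absolutely_convex[V [V0 Vcl Vc VU]].
  have [r r0 rB] := bB V V0; exists (2 * r); first by rewrite mulr_gt0.
  move=> t rt x Cx; have t0 : 0 < `|t| by apply: lt_le_trans rt; rewrite mulr_gt0.
  exists (t^-1 *: x); last by rewrite scalerA divff ?scale1r// -normr_gt0.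
  apply: VU; apply: contrapT => nV.
  have [f [Vf]] := closed_separation s Vcl Vc (nbhs_singleton V0) nV.
  apply/negP; rewrite -leNgt -(normr_le1 s) dualZ normrM normfV mulrC ler_pdivrMr// mul1r.
  apply: le_trans rt.
  have /Cx : [set 2^-1 *: f | f in polar B] (2^-1 *: (r^-1 *: f)).
    exists (r^-1 *: f) => // b Bb; have [|v Vv <-] := rB r _ b Bb; first by rewrite gtr0_norm.
    by rewrite dualZE dualZ mulrA mulVf ?gt_eqF// mul1r Vf.
  by rewrite !dualZE mulrA -invfM normrM normfV (@gtr0_norm _ (2 * r)) ?mulr_gt0//
    ler_pdivrMl ?mulr_gt0// mulr1.
pose S (l : seq (tdual E)) := C `&` [set x | forall i, (i < size l)%N ->
  nrm s (nth 0 l i x - (phi : tdual (strong_dual E)) (nth 0 l i)) <= 1].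
have phil a (f g : tdual E) : (phi : tdual (strong_dual E)) (a *: f + g : tdual E) =
    a * (phi : tdual (strong_dual E)) f + (phi : tdual (strong_dual E)) g.
  exact: (dual_linearP (phi : tdual (strong_dual E))).
have phiC (f : tdual E) : polar C f -> nrm s (phi f) < 1.
  move=> fC; have : `|phi (2 *: f : tdual E)| <= 1.
    apply: Bphi => x Bx; rewrite subr0 dualZE -dualZ; exact/fC/CB.
  have -> : phi (2 *: f : tdual E) = 2 * phi f by exact: (dualZ (phi : tdual (strong_dual E))).
  rewrite (normr_le1 s) nrmM -(inR_nat s) nrm_inR ger0_norm// => h.
  by rewrite -(ltr_pM2l (ltr0n R 2)) mulr1 (le_lt_trans h)// ltr1n.
have S0 l : S l !=set0.
  by have [x Cx xl] := finite_approximation l Cc C0 phil phiC; exists x.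
have SP : ProperFilter (filter_from [set: seq (tdual E)] S).
  apply: filter_from_proper => //; apply: filter_from_filter; first by exists [::].
  move=> l1 l2 _ _; exists (l1 ++ l2) => // x [Cx xl]; split; split => // i il.
    by have := xl i; rewrite size_cat nth_cat il; apply; exact: leq_trans il (leq_addr _ _).
  have := xl (size l1 + i)%N; rewrite size_cat nth_cat ltn_add2l.
  by rewrite [(size l1 + i < size l1)%N]ltnNge leq_addr /= addKn; exact.
have [|x [Cx xcl]] := E_compact Ccl bC SP.
  by exists [::] => // x [].
suff phix (f : tdual E) : f x = phi f.
  by exists x; apply: val_inj; apply/funext => f; exact: phix.
apply/eqP; rewrite -subr_eq0 -[_ == _]negbK -(nrm_gt0 s) -leNgt; apply/ler_addgt0Pr => e e0.
(* Scaling [f] by [2 / e] turns the two tolerances of 1 into errors of [e / 2] for [f]. *)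
rewrite add0r; pose c := inR s (2 / e); pose cf : tdual E := c *: f.
have cfE z : cf z = c * f z by [].
have [||y [[_ yS] xy]] := xcl (S [:: cf]) [set y | `|cf (y - x)| <= 1].
- by exists [:: cf].
- apply/nbhs_shift0; apply: filterS (dual_ball_nbhs cf) => z /=.
  by rewrite addrAC subrr add0r.
suff key : nrm s (cf y - phi cf) <= 1 -> `|cf (y - x)| <= 1 -> nrm s (f x - phi f) <= e.
  exact: key (yS 0%N erefl) xy.
have -> : phi cf = c * phi f by exact: (dualZ (phi : tdual (strong_dual E))).
rewrite !cfE (normr_le1 s) -mulrBr !nrmM dualB nrm_inR gtr0_norm ?divr_gt0//.
rewrite -!ler_pdivlMl ?divr_gt0// !mulr1 invf_div => h1 h2.
have -> : f x - phi f = - (f y - f x) + (f y - phi f) by rewrite opprB addrA subrK.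
by rewrite (le_trans (nrmD _ _ _))// nrmN (splitr e) lerD.
Qed.

Lemma eval_bidual_inverse_continuous (g : strong_dual (strong_dual E) -> E) :
  cancel g (@eval_bidual K E) -> continuous g.
Proof.
move=> gK phi A /nbhs_shift0/nbhs0_absolutely_convex[V [V0 Vcl Vc VA]].
suff : nbhs phi (g @^-1` A) by [].
apply/nbhs_strong_dual; exists (polar V); first exact: polar_strong_bounded.
move=> h; rewrite -[h in h - _]gK -[phi in _ - phi]gK => /(eval_bidual_sub_nbhs V0 Vcl Vc)/VA.
by rewrite /= addrC subrK.
Qed.

Lemma compact_montel : montel E.
Proof.
split=> //; split; [exact: eval_bidual_linear|exact: eval_bidual_continuous|].
have [g gK] := choice eval_bidual_surj.
exists g; split=> [x|//|]; first by apply: eval_bidual_inj; exact: gK.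
exact: eval_bidual_inverse_continuous.
Qed.

End reflexivity.

(** * Dual and barrels of the weak topology *)

Section weak_space.
Context (R : realType) (K : numFieldType) (s : scalars R K) (E : tvsType K).

Lemma weak_dual (f : tdual E) : exists g : tdual (weak_space E), g = f :> (E -> K^o).
Proof.
apply: (@linear_bounded_dual K (weak_space E) f (prepolar [set f])).
- exact: (dualP f).1.
- apply/(nbhs_weak_space (0 : weak_space E)); exists [set f]; first exact: finite_set1.
  by move=> y; rewrite subr0.
- by move=> x; exact.
Qed.

Lemma nbhs_weak_nbhs (x : E) (A : set E) : nbhs (x : weak_space E) A -> nbhs x A.
Proof.
move=> /(nbhs_weak_space (x : weak_space E))[F fF FA].
apply/nbhs_shift0.
have : nbhs (0 : E) (prepolar F).
  have [r ->] : exists r : seq (tdual E), F = [set` r] by exact/finite_seqP.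
  elim: r => [|f r ih]; first by apply: filterS (filterT : nbhs (0 : E) setT) => y _ f.
  apply: filterS (filterI (dual_ball_nbhs f) ih) => y [/= fy ry] g /=.
  by rewrite inE => /predU1P[->//|gr]; exact: ry.
by apply: filterS => z Fz; apply: FA; rewrite addrAC subrr add0r.
Qed.

Lemma dual_weak (f : tdual (weak_space E)) : exists g : tdual E, g = f :> (E -> K^o).
Proof.
apply: (@linear_bounded_dual K E f [set x | `|f x| <= 1]) => //.
  exact: (dualP f).1.
by apply: nbhs_weak_nbhs; exact: dual_ball_nbhs.
Qed.

(** By separation, a closed absolutely convex set is also weakly closed. *)
Lemma barrel_weak (T : set E) : barrel (T : set (weak_space E)) <-> barrel T.
Proof.
split=> -[Tcl Ta Tc]; split => // x clx.
  by apply: Tcl => A /nbhs_weak_nbhs; exact: clx.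
apply: contrapT => nTx.
have T0 : T 0.
  by have [r r0 /(_ r)] := Ta 0; rewrite gtr0_norm// => /(_ (lexx _) 0 erefl)[u Tu _];
    exact: (absolutely_convex0 Tc Tu).
have [f [Tf fx]] := closed_separation s Tcl Tc T0 nTx.
pose e := nrm s (f x) - 1; have e0 : 0 < e by rewrite subr_gt0.
(* The scaling makes [f y] differ from [f x] by at most [e / 2], half of the margin by which [f x]
   exceeds 1. *)
have [|y [Ty fyx]] := clx (fun y => prepolar [set inR s (2 / e) *: f] (y - x : E)).
  by apply/(nbhs_weak_space (x : weak_space E)); exists [set inR s (2 / e) *: f];
    [exact: finite_set1|].
have := fyx _ erefl; rewrite dualZE (normr_le1 s) nrmM nrm_inR gtr0_norm ?divr_gt0//.
rewrite -ler_pdivlMl ?divr_gt0// mulr1 invf_div dualB => yx.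
have := Tf y Ty; rewrite (normr_le1 s) => fy.
have fxE : f x = f y + - (f y - f x) by rewrite opprB addrCA subrr addr0.
have := nrmD s (f y) (- (f y - f x)); rewrite -fxE nrmN.
move: yx fy e0; rewrite /e; lra.
Qed.

Lemma barrel_bounded_weak (B : set E) :
  barrel_bounded (B : set (weak_space E)) <-> barrel_bounded B.
Proof. by split=> bB U /barrel_weak; exact: bB. Qed.

Lemma null_uniform_weak : null_uniform s (weak_space E) <-> null_uniform s E.
Proof.
split=> unif u u0 B /barrel_bounded_weak bB.
  have [v vu] := choice (fun n => weak_dual (u n)).
  have [|N vN] := unif v _ B bB.
    by move=> x e /(u0 x e)[N uN]; exists N => n /uN; rewrite vu.
  by exists N => n Nn x Bx; have := vN n Nn x Bx; rewrite vu.
have [v vu] := choice (fun n => dual_weak (u n)).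
have [|N vN] := unif v _ B bB.
  by move=> x e /(u0 x e)[N uN]; exists N => n /uN; rewrite vu.
by exists N => n Nn x Bx; have := vN n Nn x Bx; rewrite vu.
Qed.

End weak_space.

(** * The JNP in terms of null sequences *)

Section JNP.
Context (R : realType) (K : numFieldType) (s : scalars R K) (E : tvsType K).

Lemma weakstar_nullP (u : nat -> tdual E) (f : tdual E) :
  (u : nat -> weakstar_dual E) @ \oo --> (f : weakstar_dual E) <->
  weakstar_null s (fun n => u n - f).
Proof.
split=> [uf x e e0|u0 A].
  have : nbhs (f : weakstar_dual E) [set g : tdual E | polar [set inR s e^-1 *: x] (g - f)].
    apply/nbhs_weakstar_dual; exists [set inR s e^-1 *: x] => //; exact: finite_set1.
  move=> /uf[N _ uN]; exists N => n /uN /(_ _ erefl).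
  by rewrite dualZ (normr_le1 s) nrmM nrm_inR gtr0_norm ?invr_gt0// ler_pdivrMl// mulr1.
move=> /nbhs_weakstar_dual[B /finite_seqP[r ->] BA].
suff [N Nu] : exists N, forall n, (N <= n)%N -> polar [set` r] (u n - f).
  by exists N => // n /= /Nu; exact: BA.
elim: r {BA} => [|x r [N ih]]; first by exists 0%N => n _ x.
have [N' uN'] := u0 x 1 ltr01; exists (maxn N N') => n; rewrite geq_max => /andP[Nn N'n] y /=.
by rewrite inE => /predU1P[->|]; [rewrite (normr_le1 s) uN'|exact: ih].
Qed.

Lemma betastar_nullP (u : nat -> tdual E) (f : tdual E) :
  (u : nat -> betastar_dual E) @ \oo --> (f : betastar_dual E) <->
  forall B, barrel_bounded B -> exists N, forall n, (N <= n)%N ->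
    forall x, B x -> nrm s ((u n - f) x) <= 1.
Proof.
split=> [uf B bB|uB A].
  have : nbhs (f : betastar_dual E) [set g : tdual E | polar B (g - f)].
    by apply/nbhs_betastar_dual; exists B.
  by move=> /uf[N _ uN]; exists N => n /uN Bu x /Bu; rewrite (normr_le1 s).
move=> /nbhs_betastar_dual[B /uB[N uN] BA]; exists N => // n /= Nn.
by apply: BA => x Bx; rewrite (normr_le1 s) uN.
Qed.

Lemma JNP_null_uniform : JNP E <-> ~ null_uniform s E.
Proof.
split; apply: contra_not => unif.
  move=> u f /weakstar_nullP/unif uf; exact/betastar_nullP.
move=> u u0; have /unif/betastar_nullP : (u : nat -> weakstar_dual E) @ \oo --> (0 : weakstar_dual E).
  apply/weakstar_nullP => x e /(u0 x e)[N uN]; exists N => n /uN.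
  by rewrite subr0.
by move=> h B /h[N uN]; exists N => n /uN Bu x /Bu; rewrite subr0.
Qed.

End JNP.

Theorem theorem2p3 (R : realType) (K : numFieldType)
    (K_real_or_complex : real_or_complex R K) (E : tvsType K)
    (E_hausdorff : hausdorff_space E)
    (E_infinite_dimensional : ~ finite_dimensional E)
    (E_frechet : frechet E R) :
  (~ montel E <-> JNP E) /\ (JNP E <-> JNP (weak_space E)).
Proof.
have [s] := real_or_complexP K_real_or_complex.
split; last first.
  apply: (iff_trans (JNP_null_uniform s E)).
  apply: iff_trans (iff_sym (JNP_null_uniform s (weak_space E))).
  exact: (not_iff_compat (iff_sym (null_uniform_weak s E))).
apply: iff_trans (iff_sym (JNP_null_uniform s E)); apply: not_iff_compat; split.
  exact: montel_null_uniform.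
move=> unif; apply: (compact_montel s E_hausdorff E_frechet) => B.
exact: (closed_bounded_compact E_frechet unif).
Qed.
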